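(* Let $N \ge 1$ and let $B_1,\dots,B_N$ be (non-random) Borel subsets of $S=[0,1]$, with $\delta_i = |B_i|$, $B' = \bigcup_{i=1}^N B_i$ and $\delta' = |B'|$, where $0<\delta'<1$. Let $p_1,\dots,p_N$ be the forecasts, $p'$ the oracular aggregator, $p_{\mathrm{probit}}$ the average-probit aggregator, and $\alpha$ the probit extremization ratio of $p'$ with respect to $p_{\mathrm{probit}}$, all under the Gaussian partial information model described in the context. Then the law of $\alpha$ is a Cauchy distribution with some location parameter $x_0$ and scale parameter $\gamma$, where $x_0 \ge 1$, and $x_0 = 1$ can occur only when $\delta_i = \delta_j$ for all $i \neq j$. Consequently, if $\delta_i \neq \delta_j$ for some $i\neq j$, then $\mathbb{P}(\alpha > 1) > 1/2$ (strictly).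
   Context: Notation: $|\cdot|$ is Lebesgue measure on $S=[0,1]$, and $\Phi$ is the standard normal CDF. Gaussian partial information model: on a probability space $(\Omega,\mathcal{F},\mathbb{P})$ let $\{X_B\}$ be a centered Gaussian process indexed by the Borel subsets $B\subseteq S$ with $\mathrm{Cov}(X_B,X_{B'})=|B\cap B'|$ (for example, $X_B$ is the white noise integral of $B$ with respect to Brownian motion on $[0,1]$). The target event is $A=\{X_S>0\}$. Forecaster $i$ has information set $B_i$ and reports $p_i=\mathbb{E}(\mathbf{1}_A\mid \sigma(X_{B_i}))=\Phi\big(X_{B_i}/\sqrt{1-\delta_i}\big)$, where $\delta_i=|B_i|$. Oracular aggregator: $p'=\mathbb{P}(X_S>0\mid X_{B'})=\Phi\big(X_{B'}/\sqrt{1-\delta'}\big)$, where $B'=\bigcup_{i=1}^N B_i$ and $\delta'=|B'|$. Average-probit aggregator: $p_{\mathrm{probit}}=\Phi\big(\frac1N\sum_{i=1}^N\Phi^{-1}(p_i)\big)$. Probit extremization ratio: $\alpha=\alpha(p',p_{\mathrm{probit}})=\Phi^{-1}(p')/\Phi^{-1}(p_{\mathrm{probit}})=\Phi^{-1}(p')\Big/\Big(\frac1N\sum_{i=1}^N\Phi^{-1}(p_i)\Big)$, defined almost surely. Convention: a Cauchy distribution with location $x_0$ and scale $\gamma>0$ has density $\frac{1}{\pi\gamma}\big(1+((x-x_0)/\gamma)^2\big)^{-1}$; for $\gamma=0$ it is understood as the degenerate distribution, the point mass at $x_0$. *)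

(* Defs.v *)
From HB Require Import structures.
From mathcomp Require Import all_boot all_order all_algebra.
From mathcomp Require Import all_classical all_reals all_analysis.

Set Implicit Arguments.
Unset Strict Implicit.
Unset Printing Implicit Defensive.

Import Order.TTheory GRing.Theory Num.Theory.
Import numFieldNormedType.Exports.

Local Open Scope classical_set_scope.
Local Open Scope ring_scope.

Section laws.
Context {R : realType}.

Definition has_law d (Omega : measurableType d) (P : probability Omega R)
    (Y : Omega -> R) (nu : set R -> \bar R) : Prop :=
  measurable_fun setT Y /\
  forall U : set R, measurable U -> P (Y @^-1` U) = nu U.

(* The library's [normal_prob m 0] is the uniform law on [0, 1], not the point
   mass at [m], hence the case analysis. *)
Definition gaussian_law (m s : R) (U : set R) : \bar R :=
  if s == 0 then \d_m U else normal_prob m s U.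

Definition cauchy_pdf (x0 g x : R) : R :=
  (pi * g)^-1 * (1 + ((x - x0) / g) ^+ 2)^-1.

Definition cauchy_law (x0 g : R) (U : set R) : \bar R :=
  if g == 0 then \d_x0 U
  else (\int[lebesgue_measure]_(x in U) (cauchy_pdf x0 g x)%:E)%E.

Definition Phi (x : R) : R := fine (normal_prob 0 1 `]-oo, x]).

(* Phi is a bijection from R onto ]0, 1[; outside ]0, 1[ the value is 0. *)
Definition probit (p : R) : R := xget 0 [set x | Phi x = p].

End laws.

Section model.
Context {R : realType} {d : measure_display} {Omega : measurableType d}
  (P : probability Omega R).

Definition gaussian_process (I : Type) (D : set I) (X : I -> Omega -> R) : Prop :=
  forall (n : nat) (t : 'I_n -> I) (c : 'I_n -> R), (forall k, D (t k)) ->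
    exists m s : R, 0 <= s /\
      has_law P (fun w => \sum_(k < n) c k * X (t k) w) (gaussian_law m s).

Definition unit_borel : set (set R) :=
  [set B : set R | measurable B /\ B `<=` `[0, 1]].

(* [X B] is unconstrained (arbitrary) when [B] is not a Borel subset of [0, 1]. *)
Definition gaussian_partial_information (X : set R -> Omega -> R) : Prop :=
  [/\ gaussian_process unit_borel X,
      forall B, unit_borel B -> expectation P (X B) = 0%E &
      forall B B', unit_borel B -> unit_borel B' ->
        covariance P (X B) (X B') = lebesgue_measure (B `&` B')].

Definition target_event (X : set R -> Omega -> R) : set Omega :=
  [set w | 0 < X `[0, 1]%classic w].

(* [g] is a version of the conditional expectation of [f] given the
   sub-sigma-algebra [G]. *)
Definition is_cond_expectation (G : set (set Omega)) (f g : Omega -> R) : Prop :=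
  [/\ forall U : set R, measurable U -> G (g @^-1` U),
      P.-integrable setT (EFin \o g) &
      forall E, G E ->
        (\int[P]_(w in E) (g w)%:E = \int[P]_(w in E) (f w)%:E)%E].

(* [p] is a version of E(1_A | sigma(X_B)). *)
Definition is_forecast (X : set R -> Omega -> R) (B : set R) (p : Omega -> R) :
    Prop :=
  is_cond_expectation (g_sigma_algebra_preimage (X B)) \1_(target_event X) p.

End model.

Section aggregators.
Context {R : realType} {T : Type}.

Definition average_probit N (p : 'I_N -> T -> R) (w : T) : R :=
  Phi (N%:R^-1 * \sum_(i < N) probit (p i w)).

Definition extremization_ratio (p' q : T -> R) (w : T) : R :=
  probit (p' w) / probit (q w).

End aggregators.

(* Main.v *)
Require Import Defs.
From HB Require Import structures.
From mathcomp Require Import all_boot all_order all_algebra.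
From mathcomp Require Import all_classical all_reals all_analysis.
From mathcomp Require Import measurable_realfun.
From mathcomp Require Import ring lra.

Set Implicit Arguments.
Unset Strict Implicit.
Unset Printing Implicit Defensive.

Import Order.TTheory GRing.Theory Num.Theory.
Import numFieldNormedType.Exports.

Local Open Scope classical_set_scope.
Local Open Scope ring_scope.

(* Write X_c for a finite linear combination of the X_B; by hypothesis it is
   Gaussian and centered, with variance given by a quadratic form in c.
   Two such combinations with zero covariance are independent: every combination
   of the two has a known law, so E[(1 + cos(bV + c))(1 + cos(r(U - u)))]
   factors, and a finite weighted law of U is determined by the integrals of
   1 + cos(r(U - u)).  The latter holds because integrating against
   e^{-er} dr yields the Poisson kernel e / (e^2 + (U - u)^2), whose integral
   over a half-line converges to an indicator function as e tends to 0.

   Since X_S - X_B is independent of X_B, the forecast is a.s. Phi(X_B / sd), so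
   alpha = U / V a.s., where V is the average of the X_{B_i} / sd_i and
   U = X_{B'} / sd'.  With x0 = Cov(U, V) / Var(V), the residual U - x0 V is
   independent of V, hence alpha is x0 plus a ratio of independent centered
   Gaussians, that is, a Cauchy variable centered at x0.  Finally, sd' <= sd_j and
   |B_i n B_j| <= |B_i| give Var(V) <= Cov(U, V) term by term, and equality
   forces every sd_j to be sd'.

   The second moment kappa of the standard normal law is only known here to be
   finite and positive, by comparison with the variance of X_S, and is therefore
   carried along as a factor. *)

(** * Half-lines, Tonelli on a subset, and image measures with a density *)

Section half_lines.
Context {R : realType}.

(** Closed upper half-lines are stable under intersection and generate the Borel sets, and the
    half-lines from -n on exhaust the line with finite mass. *)
Lemma eq_measure_half_lines (m1 m2 : {measure set (measurableTypeR R) -> \bar R}) :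
  (m1 setT < +oo)%E -> (forall a, m1 `[a, +oo[%classic = m2 `[a, +oo[%classic) ->
  forall A, measurable A -> m1 A = m2 A.
Proof.
move=> m1oo m12 A mA.
apply: (@measure_unique _ R (measurableTypeR R) (@measurable_realfun.RGenCInfty.G R)
  (fun n : nat => `[(- n%:R)%R, +oo[%classic) _ _ _ _ m1 m2 _ _ A mA) => //.
- exact: measurable_realfun.RGenCInfty.measurableE.
- move=> _ _ [x ->] [y ->]; exists (Num.max x y).
  by apply/seteqP; split => z /=; rewrite !in_itv/= !andbT ge_max => /andP.
- by move=> i; exists (- i%:R).
- apply/seteqP; split => // x _; exists (Num.truncn (- x)).+1 => //=.
  by rewrite in_itv/= andbT lerNl ltW// Num.Theory.truncnS_gt.
- by move=> _ [x ->].
- move=> k; apply: le_lt_trans m1oo; apply: le_measure => //; rewrite inE//.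
Qed.

End half_lines.

Section tonelli.
Context d1 d2 (T1 : measurableType d1) (T2 : measurableType d2) (R : realType).
Variables (m1 : {sigma_finite_measure set T1 -> \bar R})
  (m2 : {sigma_finite_measure set T2 -> \bar R}).

(** Multiplying by the indicator of [D] in the second variable reduces the claim to Tonelli on the
    whole product. *)
Lemma tonelli_on (D : set T2) (f : (T1 * T2)%type -> \bar R) :
  measurable D -> measurable_fun setT f -> (forall z, 0 <= f z)%E ->
  (\int[m1]_x \int[m2]_(y in D) f (x, y) =
   \int[m2]_(y in D) \int[m1]_x f (x, y))%E.
Proof.
move=> mD mf f0.
pose g z := (f z * (\1_D z.2)%:E)%E.
have mg : measurable_fun setT g.
  apply: emeasurable_funM => //; apply/measurable_EFinP.
  by apply: measurableT_comp => //; exact: measurable_indic.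
have g0 z : (0 <= g z)%E by rewrite mule_ge0.
transitivity (\int[m1]_x \int[m2]_y g (x, y))%E.
  apply: eq_integral => x _; rewrite integral_mkcond; apply: eq_integral => y _.
  by rewrite epatch_indic.
rewrite (@fubini_tonelli _ _ _ _ _ m1 m2 g mg g0) [RHS]integral_mkcond.
apply: eq_integral => y _.
rewrite epatch_indic /= /g -ge0_integralZr//=; exact: measurableT_comp.
Qed.

End tonelli.

Section weighted_law.
Context d (T : measurableType d) (R : realType) (P : {measure set T -> \bar R}).
Variables (U : T -> measurableTypeR R) (G : T -> R).
Hypotheses (mU : measurable_fun setT U) (mG : measurable_fun setT G)
  (G0 : forall w, 0 <= G w).

(** The image under [U] of the measure with density [G]. The hypotheses are arguments so that a
    measure structure can be attached to the function. *)
Definition weighted_law of measurable_fun setT U & measurable_fun setT G &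
    (forall w, 0 <= G w) :=
  fun A : set (measurableTypeR R) => (\int[P]_(w in U @^-1` A) (G w)%:E)%E.

Local Notation nu := (weighted_law mU mG G0).

Let nu0 : nu set0 = 0%E.
Proof. by rewrite /weighted_law preimage_set0 integral_set0. Qed.

Let nu_ge0 A : (0 <= nu A)%E.
Proof. by apply: integral_ge0 => w _; rewrite lee_fin. Qed.

Let nu_sigma_additive : semi_sigma_additive nu.
Proof.
move=> F mF tF mUF; rewrite /weighted_law preimage_bigcup.
have mUF' n : measurable (U @^-1` F n) by rewrite -[X in measurable X]setTI; exact: mU.
rewrite ge0_integral_bigcup//.
- apply: is_cvg_ereal_nneg_natsum_cond => n _ _.
  by apply: integral_ge0 => w _; rewrite lee_fin.
- by apply: measurable_funTS; exact/measurable_EFinP.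
- by move=> w _; rewrite lee_fin.
- apply/trivIsetP => i j _ _ ij; rewrite -preimage_setI.
  by move/trivIsetP : tF => /(_ _ _ I I ij) ->; rewrite preimage_set0.
Qed.

HB.instance Definition _ := isMeasure.Build _ _ _ nu nu0 nu_ge0 nu_sigma_additive.

End weighted_law.

(** * Affine images of the standard normal law *)

Section normal_affine.
Context {R : realType}.
Local Notation gamma := (normal_prob 0 1 : probability (measurableTypeR R) R).

Lemma normal_pdf_affine (m s x : R) : 0 < s ->
  normal_pdf m s x = normal_pdf 0 1 (s^-1 * (x - m)) * s^-1.
Proof.
move=> s0; rewrite !normal_pdfE ?oner_neq0 ?gt_eqF// /normal_peak /normal_fun.
rewrite subr0 expr1n mul1r -mulrnAr sqrtrM ?sqr_ge0// sqrtr_sqr gtr0_norm//.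
rewrite invfM -!mulrA mulrCA; congr (_ * _); rewrite mulrC; congr (expR _ * _).
by field; rewrite gt_eqF.
Qed.

Lemma normal_pdfN (m s x : R) : normal_pdf m (- s) x = normal_pdf m s x.
Proof.
rewrite /normal_pdf oppr_eq0; case: ifPn => // s0.
by rewrite /normal_peak /normal_fun sqrrN.
Qed.

Lemma derive1_affine (m s : R) : derive1 (fun x : R => s * (x - m)) = cst s.
Proof.
apply/funext => x; rewrite derive1E deriveM//= derive_cst scaler0 addr0.
by rewrite deriveB// derive_id derive_cst subr0 /GRing.scale/= mulr1.
Qed.

Lemma cvgy_affine (m s : R) : 0 < s ->
  s * (x - m) @[x --> +oo] --> +oo.
Proof. by move=> s0; apply: gt0_cvgMry => //; exact: cvg_addrr. Qed.

Lemma normal_half_line (m s a : R) : 0 < s ->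
  normal_prob m s `[a, +oo[%classic = normal_prob 0 1 `[s^-1 * (a - m), +oo[%classic.
Proof.
move=> s0; rewrite /normal_prob.
rewrite (@increasing_ge0_integration_by_substitutiony _ (fun x => s^-1 * (x - m))).
- apply: eq_integral => x _.
  by rewrite derive1_affine normal_pdf_affine.
- move=> x y _ _ xy; rewrite ltr_pM2l ?invr_gt0//; lra.
- by rewrite derive1_affine => x _; exact: cvg_cst.
- by rewrite derive1_affine; exact: is_cvg_cst.
- by rewrite derive1_affine; exact: is_cvg_cst.
- have cf : continuous (fun x : R => s^-1 * (x - m)).
    by move=> x; apply: cvgMr; apply: cvgB; [exact: cvg_id|exact: cvg_cst].
  split; last exact: cvg_at_right_filter (cf a).
  by move=> x _; apply: derivableM => //; exact: derivableB.
- by apply: cvgy_affine; rewrite invr_gt0.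
- by apply: continuous_subspaceT; apply: continuous_normal_pdf; exact: oner_neq0.
- by move=> x _; exact: normal_pdf_ge0.
Qed.

Lemma normal_half_lineN (a : R) :
  normal_prob 0 1 `]-oo, - a]%classic = normal_prob 0 1 `[a, +oo[%classic :> \bar R.
Proof.
rewrite /normal_prob ge0_integration_by_substitutionNy.
- apply: eq_integral => x _ /=; rewrite !normal_pdfE ?oner_neq0// /normal_fun.
  by rewrite !subr0 sqrrN.
- by apply: continuous_subspaceT; apply: continuous_normal_pdf; exact: oner_neq0.
- by move=> x _; exact: normal_pdf_ge0.
Qed.

(** The two measures are compared on half-lines. For [s < 0] the affine map reverses half-lines,
    which the symmetry of the standard law and the evenness of [normal_pdf] in [s] undo. *)
Lemma normal_prob_affine (m s : R) : s != 0 -> forall A, measurable A ->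
  normal_prob 0 1 ((fun x => m + s * x) @^-1` A) = normal_prob m s A.
Proof.
move=> s0 A mA.
have mf : measurable_fun setT (fun x : R => m + s * x).
  by apply: measurable_funD => //; exact: measurable_funM.
have mpre B : measurable B -> measurable ((fun x => m + s * x) @^-1` B).
  by move=> mB; rewrite -[X in measurable X]setTI; exact: mf.
(* With constant weight 1, [weighted_law] is the plain image measure. *)
pose one := cst 1 : R -> R.
have mone : measurable_fun setT one by exact: measurable_cst.
have one0 (x : R) : 0 <= one x by exact: ler01.
have nuE B : measurable B -> weighted_law (normal_prob 0 1) mf mone one0 B =
    normal_prob 0 1 ((fun x => m + s * x) @^-1` B).
  by move=> mB; rewrite -[RHS]mul1e -integral_cst//; exact: mpre.
rewrite -nuE//.
refine (@eq_measure_half_lines _ (weighted_law (normal_prob 0 1) mf mone one0) (normal_prob m s) _ _ A mA).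
  by rewrite /= nuE// preimage_setT probability_setT ltry.
move=> a; rewrite [LHS]nuE//=.
have [s_gt0|] := ltP 0 s.
  rewrite normal_half_line//; congr normal_prob.
  apply/seteqP; split => x /=; rewrite !in_itv/= !andbT ler_pdivrMl//; lra.
rewrite le_eqVlt (negbTE s0)/= => s_lt0.
have -> : normal_prob m s `[a, +oo[%classic = normal_prob m (- s) `[a, +oo[%classic.
  by apply: eq_integral => x _; rewrite normal_pdfN.
rewrite normal_half_line ?oppr_gt0// -normal_half_lineN; congr normal_prob.
apply/seteqP; split => x /=; rewrite !in_itv/= !andbT -mulNr -invrN opprK ler_ndivlMl//; lra.
Qed.

Lemma normal_preimageN (A : set R) : measurable A ->
  gamma ((fun x => - x) @^-1` A) = gamma A.
Proof.
move=> mA; have N1 : -1 != 0 :> R by rewrite oppr_eq0 oner_neq0.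
have -> : (fun x : R => - x) = (fun x => 0 + -1 * x).
  by apply/funext => x; rewrite add0r mulN1r.
transitivity (normal_prob 0 (-1) A); first exact: normal_prob_affine.
by apply: eq_integral => x _; rewrite normal_pdfN.
Qed.

(** For [s = 0] the affine map is constant and the image law is the point mass, so one formula
    covers both cases of [gaussian_law]. *)
Lemma gaussian_lawE (m s : R) A : measurable A ->
  gaussian_law m s A = normal_prob 0 1 ((fun x => m + s * x) @^-1` A).
Proof.
move=> mA; rewrite /gaussian_law; case: ifPn => [/eqP ->|s0].
  rewrite diracE; have [mA'|mA'] := boolP (m \in A).
    rewrite (_ : _ @^-1` _ = setT) ?probability_setT//.
    by apply/seteqP; split => x //= _; rewrite mul0r addr0; exact: set_mem.
  rewrite (_ : _ @^-1` _ = set0) ?measure0//.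
  apply/seteqP; split => x //=; rewrite mul0r addr0 => Am.
  by move: mA'; rewrite mem_set.
by rewrite normal_prob_affine.
Qed.

End normal_affine.

(** * The cosine transform determines a weighted law *)

Section improper_integrals.
Context {R : realType}.
Local Notation mu := (@lebesgue_measure R).

Lemma is_derive_continuous (f : R -> R) (x df : R) :
  is_derive x 1 f df -> {for x, continuous f}.
Proof. by move=> [dfx _]; apply: differentiable_continuous; exact/derivable1_diffP. Qed.

Lemma ge0_is_derive_FTC2y (f F : R -> R) (a l : R) :
  (forall x, a <= x -> 0 <= f x) ->
  (forall x : R, is_derive x 1 F (f x)) -> continuous f ->
  F x @[x --> +oo] --> l ->
  (\int[mu]_(x in `[a, +oo[) (f x)%:E = l%:E - (F a)%:E)%E.
Proof.
move=> f0 dF cf Fl; apply: ge0_continuous_FTC2y => //.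
- exact: continuous_subspaceT.
- exact: cvg_at_right_filter (is_derive_continuous (dF a)).
- by move=> x _; rewrite derive1E; apply: derive_val.
Qed.

Lemma cvgr_expRM (e : R) : 0 < e -> expR (- (e * t)) @[t --> +oo] --> 0.
Proof.
move=> e0; apply: (cvg_comp (fun t => e * t) (fun t => expR (- t))).
  by apply: gt0_cvgMry => //; exact: cvg_id.
exact: cvgr_expR.
Qed.

(** The added 1 keeps the integrand nonnegative, so that Tonelli applies later; it contributes the
    term [e^-1] next to the Poisson kernel. *)
Lemma laplace_cos (e x : R) : 0 < e ->
  (\int[mu]_(t in `[0%R, +oo[) (expR (- (e * t)) * (1 + cos (t * x)))%:E =
   (e^-1 + e / (e ^+ 2 + x ^+ 2))%:E)%E.
Proof.
move=> e0.
have D0 : e ^+ 2 + x ^+ 2 != 0 by rewrite gt_eqF// ltr_pwDl ?exprn_gt0 ?sqr_ge0.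
pose D := e ^+ 2 + x ^+ 2.
(* The functions are built from scalings of the identity so that their derivatives are found by
   instance resolution. *)
pose lin (k : R) : R -> R := k *: (@idfun R : R -> R^o).
pose E := expR \o lin (- e).
(* An antiderivative of the integrand, equal to -(e/D + 1/e) at 0 and tending to 0 at infinity. *)
pose F : R -> R := E * (((x / D) *: ((sin \o lin x : R -> R) : R -> R^o) : R -> R) -
              ((e / D) *: ((cos \o lin x : R -> R) : R -> R^o) : R -> R) - cst e^-1).
pose f : R -> R := E * (cst 1 + (cos \o lin x)).
have lE k t : lin k t = k * t by [].
have EE t : E t = expR (- (e * t)) by rewrite /E /= lE mulNr.
have dF (t : R) : is_derive t 1 F (f t).
  apply: is_derive_eq.
  rewrite /f /E !fctE /GRing.scale/= !lE /GRing.scale/= /D.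
  by field; rewrite gt_eqF.
have cf : continuous f by move=> t; apply: is_derive_continuous.
have -> : (\int[mu]_(t in `[0%R, +oo[) (expR (- (e * t)) * (1 + cos (t * x)))%:E =
    \int[mu]_(t in `[0%R, +oo[) (f t)%:E)%E.
  by apply: eq_integral => t _; rewrite /f /E !fctE !lE mulNr (mulrC x).
rewrite (@ge0_is_derive_FTC2y f F 0 0)//.
- rewrite -EFinB /F /E !fctE /GRing.scale/= !lE !mulr0 expR0 sin0 cos0 /D.
  by congr EFin; field; rewrite D0 gt_eqF.
- move=> t _; rewrite /f /E !fctE mulr_ge0 ?expR_ge0// -lerBlDl sub0r cos_geN1.
- pose K := `|x / D| + `|e / D| + e^-1.
  apply: (@squeeze_cvgr _ _ _ _ (fun t => - (K * expR (- (e * t)))) (fun t => K * expR (- (e * t)))).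
  + apply: nearW => t; rewrite -ler_norml /F !fctE normrM mulrC.
    rewrite EE (ger0_norm (expR_ge0 _)) ler_wpM2r ?expR_ge0//.
    apply: le_trans (ler_normB _ _) _; apply: lerD; last first.
      by rewrite ger0_norm// invr_ge0 ltW.
    apply: le_trans (ler_normB _ _) _; by rewrite lerD// normrM ler_piMr// ?sin_max ?cos_max.
  + by rewrite -oppr0; apply: cvgN; rewrite -(mulr0 K); apply: cvgMr; exact: cvgr_expRM.
  + by rewrite -(mulr0 K); apply: cvgMr; exact: cvgr_expRM.
Qed.

Lemma is_derive_atan_affine (m g x : R) :
  is_derive x 1 (fun x => atan (g^-1 * (x - m))) (g^-1 * (1 + (g^-1 * (x - m)) ^+ 2)^-1).
Proof.
pose h : R -> R := g^-1 *: ((idfun : R -> R^o) - cst m).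
rewrite (_ : (fun _ => _) = atan \o h)//.
by apply: is_derive_eq; rewrite /GRing.scale/= subr0 mulr1 mulrC.
Qed.

Lemma cauchy_half_line (m g a : R) : 0 < g ->
  (\int[mu]_(u in `[a, +oo[) (g^-1 * (1 + (g^-1 * (u - m)) ^+ 2)^-1)%:E =
   (pi / 2 - atan (g^-1 * (a - m)))%:E)%E.
Proof.
move=> g0; rewrite EFinB.
pose h : R -> R := g^-1 *: ((idfun : R -> R^o) - cst m).
pose q : R -> R := cst 1 + h ^+ 2.
have q0 u : q u != 0 by rewrite gt_eqF// /q !fctE ltr_pwDl// sqr_ge0.
have cq : continuous q by move=> u; apply: is_derive_continuous.
have cf : continuous (fun u => g^-1 * (1 + (g^-1 * (u - m)) ^+ 2)^-1).
  by move=> u; apply: cvgMr; exact: (continuousV (s := q) (q0 u) (cq u)).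
apply: (@ge0_is_derive_FTC2y _ (fun u => atan (g^-1 * (u - m))) a (pi / 2) _ (is_derive_atan_affine m g) cf).
- by move=> u _; rewrite mulr_ge0 ?invr_ge0 ?addr_ge0 ?sqr_ge0// ltW.
- by apply: (cvg_comp (fun u => g^-1 * (u - m)) atan _ (@cvgy_atan R));
  apply: cvgy_affine; rewrite invr_gt0.
Qed.

(** As a function of [u], the Poisson kernel is pi times the Cauchy density with location [x] and
    scale [e]. *)
Lemma poisson_half_line (e a x : R) : 0 < e ->
  (\int[mu]_(u in `[a, +oo[) (e / (e ^+ 2 + (x - u) ^+ 2))%:E =
   (pi / 2 - atan (e^-1 * (a - x)))%:E)%E.
Proof.
move=> e0; rewrite -cauchy_half_line//; apply: eq_integral => u _.
congr EFin; have D0 : e ^+ 2 + (x - u) ^+ 2 != 0.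
  by rewrite gt_eqF// ltr_pwDl ?exprn_gt0 ?sqr_ge0.
rewrite exprMn exprVn -(sqrrN (u - x)) opprB.
have -> : 1 + e ^- 2 * (x - u) ^+ 2 = e ^- 2 * (e ^+ 2 + (x - u) ^+ 2).
  by rewrite mulrDr mulVf// expf_neq0// gt_eqF.
by field; rewrite D0 gt_eqF.
Qed.

End improper_integrals.

Section measurable_kernels.
Context d (T : measurableType d) (R : realType).
Implicit Types a b : T -> R.

Lemma measurable_expcos a b (e : R) :
  measurable_fun setT a -> measurable_fun setT b ->
  measurable_fun setT (fun z => expR (- (e * a z)) * (1 + cos (a z * b z))).
Proof.
move=> ma mb; apply: measurable_funM.
  by apply: measurableT_comp => //; apply: measurableT_comp => //; exact: measurable_funM.
apply: measurable_funD => //; apply: measurableT_comp; last exact: measurable_funM.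
by apply: continuous_measurable_fun; exact: continuous_cos.
Qed.

Lemma measurable_poisson a (e : R) : 0 < e -> measurable_fun setT a ->
  measurable_fun setT (fun z => e / (e ^+ 2 + a z ^+ 2)).
Proof.
move=> e0 ma.
suff mh : measurable_fun setT (fun x : R => e / (e ^+ 2 + x ^+ 2)) by exact: measurableT_comp mh ma.
pose q : R -> R := cst (e ^+ 2) + (@idfun R) ^+ 2.
have q0 u : q u != 0 by rewrite gt_eqF// /q !fctE ltr_pwDl ?exprn_gt0//; exact: sqr_ge0.
have cq : continuous q by move=> u; apply: is_derive_continuous.
apply: continuous_measurable_fun => x; apply: cvgMr.
exact: (continuousV (s := q) (q0 x) (cq x)).
Qed.

End measurable_kernels.

Lemma integrable_bounded d (T : measurableType d) (R : realType)
    (P : probability T R) (G : T -> R) (C : R) :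
  measurable_fun setT G -> (forall w, `|G w| <= C) -> P.-integrable setT (EFin \o G).
Proof.
move=> mG GC.
apply: (le_integrable _ _ _ (finite_measure_integrable_cst P C measurableT)) => //.
  exact/measurable_EFinP.
by move=> w _; rewrite /= lee_fin (le_trans (GC w))// ler_norm.
Qed.

(** * Poisson smoothing and inversion of the cosine transform *)

Section cosine_transform.
Context d (T : measurableType d) (R : realType) (P : probability T R).
Variable U : T -> R.
Hypothesis mU : measurable_fun setT U.
Local Notation mu := (@lebesgue_measure R).

Let expcos_ge0 (e t x : R) : 0 <= expR (- (e * t)) * (1 + cos (t * x)).
Proof. by rewrite mulr_ge0 ?expR_ge0// -lerBlDl sub0r cos_geN1. Qed.

Let poisson_ge0 (e x : R) : 0 < e -> 0 <= e / (e ^+ 2 + x ^+ 2).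
Proof. by move=> e0; rewrite divr_ge0 ?addr_ge0 ?sqr_ge0// ltW. Qed.

(** By Tonelli, the Laplace transform in [t] of the cosine integrals is the Poisson integral plus a
    multiple of the total mass. *)
Lemma integral_laplace_cos (G : T -> R) (e u : R) : 0 < e ->
  measurable_fun setT G -> (forall w, 0 <= G w) ->
  (\int[P]_w (G w * (e^-1 + e / (e ^+ 2 + (U w - u) ^+ 2)))%:E =
   \int[mu]_(t in `[0%R, +oo[) ((expR (- (e * t)))%:E *
     \int[P]_w (G w * (1 + cos (t * (U w - u))))%:E))%E.
Proof.
move=> e0 mG G0.
pose f (z : T * measurableTypeR R) : \bar R :=
  (G z.1 * (expR (- (e * z.2)) * (1 + cos (z.2 * (U z.1 - u)))))%:E.
have f0 z : (0 <= f z)%E by rewrite lee_fin mulr_ge0.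
have mf : measurable_fun setT f.
  apply/measurable_EFinP; apply: measurable_funM; first exact: measurableT_comp.
  apply: measurable_expcos => //; apply: measurable_funB => //.
  exact: measurableT_comp.
transitivity (\int[P]_w \int[mu]_(t in `[0%R, +oo[) f (w, t))%E.
  apply: eq_integral => w _; rewrite EFinM -laplace_cos// -ge0_integralZl_EFin//.
  apply: measurable_funTS; apply/measurable_EFinP.
  exact: measurable_expcos.
rewrite (tonelli_on P mu _ mf f0)//.
apply: eq_integral => t _; rewrite -ge0_integralZl_EFin ?expR_ge0//.
- by apply: eq_integral => w _; rewrite /f/= mulrCA EFinM.
- by move=> w _; rewrite lee_fin mulr_ge0// -lerBlDl sub0r cos_geN1.
- apply/measurable_EFinP; apply: measurable_funM => //.
  have := measurable_expcos (a := cst t) (b := fun w => U w - u) 0.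
  under [X in _ -> _ -> measurable_fun _ X]eq_fun do rewrite mul0r oppr0 expR0 mul1r.
  by apply => //; exact: measurable_funB.
Qed.

(** Tonelli again: integrating the Poisson kernel over the centers [u >= a] gives, up to the factor
    pi, a smooth approximation of the indicator of [a <= U]. *)
Lemma integral_poisson (G : T -> R) (e a : R) : 0 < e ->
  measurable_fun setT G -> (forall w, 0 <= G w) ->
  (\int[P]_w (G w * (pi / 2 - atan (e^-1 * (a - U w))))%:E =
   \int[mu]_(u in `[a, +oo[)
     \int[P]_w (G w * (e / (e ^+ 2 + (U w - u) ^+ 2)))%:E)%E.
Proof.
move=> e0 mG G0.
pose f (z : T * measurableTypeR R) : \bar R :=
  (G z.1 * (e / (e ^+ 2 + (U z.1 - z.2) ^+ 2)))%:E.
have f0 z : (0 <= f z)%E by rewrite lee_fin mulr_ge0// poisson_ge0.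
have mf : measurable_fun setT f.
  apply/measurable_EFinP; apply: measurable_funM; first exact: measurableT_comp.
  apply: measurable_poisson => //; apply: measurable_funB => //.
  exact: measurableT_comp.
rewrite -(tonelli_on P mu _ mf f0)//.
apply: eq_integral => w _; rewrite EFinM -poisson_half_line// -ge0_integralZl_EFin//.
- by move=> u _; rewrite lee_fin poisson_ge0.
- apply: measurable_funTS; apply/measurable_EFinP.
  by apply: measurable_poisson => //; exact: measurable_funB.
Qed.

(** Here [x] stands for [U w - a]; the kernel has width 1/k^2 and the threshold is a - 1/k, with k =
    n + 1. The shift is much larger than the width, so the limit at [x = 0] is pi and not pi/2, and
    the closed half-line is recovered. *)
Lemma cvg_step (x : R) :
  pi / 2 + atan (x * n.+1%:R ^+ 2 + n.+1%:R) @[n --> \oo] -->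
  (if 0 <= x then pi else 0).
Proof.
have nat_ge (A : R) : \forall n \near \oo, A <= n.+1%:R.
  near=> n; rewrite (@le_trans _ _ n%:R)// ?ler_nat//.
  by near: n; exact: nbhs_infty_ger.
case: ifPn => [x0|].
  rewrite [X in _ --> X](_ : pi = pi / 2 + pi / 2)//; last by rewrite -splitr.
  apply: cvgD; first exact: cvg_cst.
  apply: (cvg_comp _ atan _ (@cvgy_atan R)).
  apply/cvgryPge => A; near=> n; rewrite ler_wpDl ?mulr_ge0 ?sqr_ge0//.
  near: n; exact: nat_ge.
rewrite -ltNge => x0.
rewrite [X in _ --> X](_ : 0 = pi / 2 - pi / 2)//; last by rewrite subrr.
apply: cvgD; first exact: cvg_cst.
rewrite (_ : (fun n => _) = (fun n : nat => - atan (n.+1%:R * (- x * n.+1%:R - 1)))); last first.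
  by apply/funext => n; rewrite -atanN; congr atan; ring.
apply: cvgN; apply: (cvg_comp _ atan _ (@cvgy_atan R)).
apply/cvgryPge => A; near=> n.
have h1 : 1 <= n.+1%:R :> R by rewrite ler1n.
have h2 : A <= n.+1%:R by near: n; exact: nat_ge.
(* This bound gives -x k - 1 >= 1, so that the argument of the arctangent is at least k. *)
have h3 : 2 / - x <= n.+1%:R by near: n; exact: nat_ge.
apply: (le_trans h2); rewrite -[leLHS]mulr1 ler_wpM2l//.
move: h3; rewrite ler_pdivrMr ?oppr_gt0//; lra.
Unshelve. all: by end_near. Qed.

(** Dominated convergence with the constant bound [C * pi]; the pointwise limit is that of
    [cvg_step]. *)
Let integral_step (G : T -> R) (C a : R) : measurable_fun setT G ->
  (forall w, 0 <= G w <= C) ->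
  (\int[P]_w (G w * (pi / 2 - atan (((n.+1%:R ^+ 2)^-1)^-1 * (a - n.+1%:R^-1 - U w))))%:E)%E
    @[n --> \oo] --> (pi%:E * \int[P]_(w in U @^-1` `[a, +oo[) (G w)%:E)%E.
Proof.
move=> mG GC.
have C0 : 0 <= C by apply: le_trans (_ : 0 <= G point) _; case/andP: (GC point).
have mUa : measurable (U @^-1` `[a, +oo[) by rewrite -[X in measurable X]setTI; exact: mU.
have matan (b c : R) : measurable_fun setT (fun w => atan (b * (c - U w))).
  apply: measurableT_comp; first by apply: continuous_measurable_fun; exact: continuous_atan.
  by apply: measurable_funM => //; exact: measurable_funB.
have mG_ : measurable_fun setT ((fun w => (G w)%:E) \_ (U @^-1` `[a, +oo[)).
  by apply/(measurable_restrictT _ mUa); apply: measurable_funTS; exact/measurable_EFinP.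
rewrite integral_mkcond -ge0_integralZl_EFin ?pi_ge0//; last first.
  by move=> w _; rewrite epatch_indic mule_ge0// lee_fin; case/andP: (GC w).
have [] := @dominated_convergence _ T R P setT measurableT
  (fun n w => (G w * (pi / 2 - atan (((n.+1%:R ^+ 2)^-1)^-1 * (a - n.+1%:R^-1 - U w))))%:E)
  (fun w => (pi%:E * ((fun w => (G w)%:E) \_ (U @^-1` `[a, +oo[)) w)%E)
  (fun w => (C * pi)%:E).
- move=> n; apply/measurable_EFinP; apply: measurable_funM => //.
  exact: measurable_funB.
- exact: emeasurable_funM.
- apply: aeW => w _.
  rewrite (_ : (fun n => _) = (fun n => (G w * (pi / 2 +
      atan ((U w - a) * n.+1%:R ^+ 2 + n.+1%:R)))%:E)); last first.
    apply/funext => n; congr (_ * (_ + _))%:E; rewrite -atanN; congr atan.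
    set k : R := n.+1%:R; have k0 : k != 0 by rewrite pnatr_eq0.
    by clearbody k; field.
  rewrite (_ : (pi%:E * _)%E = (G w * (if 0 <= U w - a then pi else 0))%:E); last first.
    rewrite epatch_indic /= indicE (_ : (w \in _) = (0 <= U w - a)); last first.
      by apply/idP/idP; rewrite inE/= in_itv/= andbT subr_ge0.
    by case: ifPn => _; rewrite /= ?mule1 ?mule0 ?mulr0// mulrC.
  apply: cvg_EFin; first exact: nearW.
  by rewrite /=; apply: cvgMr; exact: cvg_step.
- exact: finite_measure_integrable_cst.
- apply: aeW => w n _; rewrite lee_fin normrM; have /andP[Gw GwC] := GC w.
  rewrite ger0_norm//; apply: ler_pM => //.
  have := atan_gtNpi2 (((n.+1%:R ^+ 2)^-1)^-1 * (a - n.+1%:R^-1 - U w)).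
  have := atan_ltpi2 (((n.+1%:R ^+ 2)^-1)^-1 * (a - n.+1%:R^-1 - U w)).
  move=> h1 h2; rewrite ler_norml; apply/andP; split; lra.
by [].
Qed.

(** Equal cosine integrals give equal Poisson integrals through the Laplace transform, hence equal
    masses of closed half-lines as the kernel shrinks, and half-lines determine a finite measure. *)
Theorem cos_transform_inj (G1 G2 : T -> R) (C : R) :
  measurable_fun setT G1 -> measurable_fun setT G2 ->
  (forall w, 0 <= G1 w <= C) -> (forall w, 0 <= G2 w <= C) ->
  (forall t u, \int[P]_w (G1 w * (1 + cos (t * (U w - u))))%:E =
     \int[P]_w (G2 w * (1 + cos (t * (U w - u))))%:E)%E ->
  forall A, measurable A ->
  (\int[P]_(w in U @^-1` A) (G1 w)%:E = \int[P]_(w in U @^-1` A) (G2 w)%:E)%E.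
Proof.
move=> mG1 mG2 G1C G2C G12 A mA.
have G10 w : 0 <= G1 w by case/andP: (G1C w).
have G20 w : 0 <= G2 w by case/andP: (G2C w).
(* The transform at [t = 0] is twice the total mass, which supplies the extra term of
   [integral_laplace_cos]. *)
have GE (G : T -> R) (e : R) : measurable_fun setT G -> (forall w, 0 <= G w) -> 0 < e ->
    (\int[P]_w (G w * e^-1)%:E = (e^-1 / 2)%:E * \int[P]_w (G w * (1 + cos (0 * (U w - 0))))%:E)%E.
  move=> mG G0 e0; rewrite -ge0_integralZl_EFin//.
  - by apply: eq_integral => w _; rewrite mul0r cos0 -EFinM; congr EFin; field; rewrite gt_eqF.
  - by move=> w _; rewrite lee_fin mul0r cos0 mulr_ge0.
  - by under eq_fun do rewrite mul0r cos0; apply/measurable_EFinP; exact: measurable_funM.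
  - by rewrite mulr_ge0 ?invr_ge0 ?ltW.
have DE (G : T -> R) (e u : R) : measurable_fun setT G -> (forall w, 0 <= G w) -> 0 < e ->
    (\int[P]_w (G w * (e^-1 + e / (e ^+ 2 + (U w - u) ^+ 2)))%:E =
     \int[P]_w (G w * (e / (e ^+ 2 + (U w - u) ^+ 2)))%:E + \int[P]_w (G w * e^-1)%:E)%E.
  move=> mG G0 e0; rewrite -ge0_integralD//.
  - by apply: eq_integral => w _; rewrite addrC mulrDr EFinD.
  - by move=> w _; rewrite lee_fin mulr_ge0// poisson_ge0.
  - apply/measurable_EFinP; apply: measurable_funM => //.
    by apply: measurable_poisson => //; exact: measurable_funB.
  - by move=> w _; rewrite lee_fin mulr_ge0// invr_ge0 ltW.
  - by apply/measurable_EFinP; exact: measurable_funM.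
(* Finiteness is what permits cancelling this term in the extended reals. *)
have fin2 : (\int[P]_w (G2 w * (1 + cos (0 * (U w - 0))))%:E)%E \is a fin_num.
  apply: integrable_fin_num => //; apply: (@integrable_bounded _ _ _ _ _ (C * 2)).
    by under eq_fun do rewrite mul0r cos0; exact: measurable_funM.
  by move=> w; rewrite mul0r cos0 ger0_norm ?mulr_ge0// ler_pM2r//; case/andP: (G2C w).
have K12 (e u : R) : 0 < e ->
    (\int[P]_w (G1 w * (e / (e ^+ 2 + (U w - u) ^+ 2)))%:E =
     \int[P]_w (G2 w * (e / (e ^+ 2 + (U w - u) ^+ 2)))%:E)%E.
  move=> e0.
  have : (\int[P]_w (G1 w * (e^-1 + e / (e ^+ 2 + (U w - u) ^+ 2)))%:E =
      \int[P]_w (G2 w * (e^-1 + e / (e ^+ 2 + (U w - u) ^+ 2)))%:E)%E.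
    by rewrite !integral_laplace_cos//; apply: eq_integral => t _; rewrite G12.
  rewrite !DE// !GE// G12 => /(congr1 (fun x => x - (e^-1 / 2)%:E *
    \int[P]_w (G2 w * (1 + cos (0 * (U w - 0))))%:E)%E).
  by rewrite !addeK// fin_numM.
have pi0 : (pi : R) != 0 by rewrite gt_eqF// pi_gt0.
have half a : (\int[P]_(w in U @^-1` `[a, +oo[) (G1 w)%:E =
    \int[P]_(w in U @^-1` `[a, +oo[) (G2 w)%:E)%E.
  have := integral_step (a := a) mG1 G1C.
  rewrite (_ : (fun n => _) = (fun n => (\int[P]_w (G2 w *
      (pi / 2 - atan (((n.+1%:R ^+ 2)^-1)^-1 * (a - n.+1%:R^-1 - U w))))%:E)%E)); last first.
    apply/funext => n; rewrite !integral_poisson ?invr_gt0 ?exprn_gt0//.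
    by apply: eq_integral => u _; rewrite K12 ?invr_gt0 ?exprn_gt0.
  move=> h1; have h2 := integral_step (a := a) mG2 G2C.
  have := cvg_lim (@ereal_hausdorff R) h1.
  rewrite (cvg_lim (@ereal_hausdorff R) h2).
  move=> h; rewrite -[LHS]mul1e -[RHS]mul1e -(mulVf pi0) EFinM -!muleA; congr (_ * _)%E.
  exact/esym/h.
refine (@eq_measure_half_lines _ (weighted_law P mU mG1 G10) (weighted_law P mU mG2 G20) _ half A mA).
rewrite /= /weighted_law preimage_setT; apply: integrable_lty => //.
apply: (@integrable_bounded _ _ _ _ _ C) => // w.
by rewrite ger0_norm//; case/andP: (G1C w).
Qed.

End cosine_transform.

(** * Integrals of functions of a variable depend only on its law *)

Section equal_laws.
Context d (T : measurableType d) d' (T' : measurableType d') (R : realType).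
Variables (P : probability T R) (P' : probability T' R).

Lemma eq_law_integral (L : T -> R) (L' : T' -> R) (f : R -> R) (C : R) :
  measurable_fun setT L -> measurable_fun setT L' ->
  (forall A, measurable A -> P (L @^-1` A) = P' (L' @^-1` A)) ->
  measurable_fun setT f -> (forall x, `|f x| <= C) ->
  (\int[P]_w (f (L w))%:E = \int[P']_w (f (L' w))%:E)%E.
Proof.
move=> mL mL' LL' mf fC.
pose X : {mfun T >-> measurableTypeR R} := HB.pack (L : T -> measurableTypeR R)
  (isMeasurableFun.Build _ _ T (measurableTypeR R) L mL).
pose X' : {mfun T' >-> measurableTypeR R} := HB.pack (L' : T' -> measurableTypeR R)
  (isMeasurableFun.Build _ _ T' (measurableTypeR R) L' mL').
transitivity (\int[distribution P X]_x (f x)%:E)%E.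
  rewrite integral_distribution//; first exact/measurable_EFinP.
  by apply: (@integrable_bounded _ _ _ _ _ C) => //; exact: measurableT_comp.
transitivity (\int[distribution P' X']_x (f x)%:E)%E.
  by apply: eq_measure_integral => A mA _; exact: LL'.
rewrite integral_distribution//; first exact/measurable_EFinP.
by apply: (@integrable_bounded _ _ _ _ _ C) => //; exact: measurableT_comp.
Qed.

Lemma ge0_eq_law_integral (L : T -> R) (L' : T' -> R) (f : R -> R) :
  measurable_fun setT L -> measurable_fun setT L' ->
  (forall A, measurable A -> P (L @^-1` A) = P' (L' @^-1` A)) ->
  measurable_fun setT f -> (forall x, 0 <= f x) ->
  (\int[P]_w (f (L w))%:E = \int[P']_w (f (L' w))%:E)%E.
Proof.
move=> mL mL' LL' mf f0.
pose X : {mfun T >-> measurableTypeR R} := HB.pack (L : T -> measurableTypeR R)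
  (isMeasurableFun.Build _ _ T (measurableTypeR R) L mL).
pose X' : {mfun T' >-> measurableTypeR R} := HB.pack (L' : T' -> measurableTypeR R)
  (isMeasurableFun.Build _ _ T' (measurableTypeR R) L' mL').
transitivity (\int[distribution P X]_x (f x)%:E)%E.
  by rewrite ge0_integral_distribution//; exact/measurable_EFinP.
transitivity (\int[distribution P' X']_x (f x)%:E)%E.
  by apply: eq_measure_integral => A mA _; exact: LL'.
by rewrite ge0_integral_distribution//; exact/measurable_EFinP.
Qed.

End equal_laws.

(** * Uncorrelated jointly Gaussian variables are independent *)

Section normal_convolution.
Context {R : realType}.
Local Notation mu := (@lebesgue_measure R).
Local Notation gamma := (normal_prob 0 1 : probability (measurableTypeR R) R).

(** The Radon-Nikodym derivative and [normal_pdf] have the same integral over every measurable set,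
    hence agree almost everywhere. *)
Lemma integral_normal_prob (m s C : R) (f : R -> R) : measurable_fun setT f ->
  (forall x, `|f x| <= C) ->
  (\int[normal_prob m s]_x (f x)%:E = \int[mu]_x ((f x)%:E * (normal_pdf m s x)%:E))%E.
Proof.
move=> mf fC; have dom := normal_prob_dominates m s.
have fint : (normal_prob m s).-integrable setT (EFin \o f).
  exact: (integrable_bounded (normal_prob m s) mf fC).
rewrite -(Radon_Nikodym_change_of_variables dom)//.
have mpdf : measurable_fun setT (EFin \o normal_pdf m s).
  by apply/measurable_EFinP; exact: measurable_normal_pdf.
apply: ae_eq_integral => //.
- apply: emeasurable_funM; first exact/measurable_EFinP.
  by apply: (measurable_int mu); exact: Radon_Nikodym_integrable.
- by apply: emeasurable_funM => //; exact/measurable_EFinP.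
- apply: ae_eqe_mul2l; apply: integral_ae_eq => //.
    exact: Radon_Nikodym_integrable.
  by move=> E _ mE; rewrite -Radon_Nikodym_integral.
Qed.

(** For independent standard normal x and y, and z = b y + a x, both sides are the joint density of
    (y, z): the density of y times that of z given y, and the density of z times that of y given
    z. *)
Lemma normal_pdf_disintegration (a b y z : R) : a != 0 ->
  let r := Num.sqrt (a ^+ 2 + b ^+ 2) in
  normal_pdf (b * y) a z * normal_pdf 0 1 y =
  normal_pdf 0 r z * normal_pdf (b * z / r ^+ 2) (a / r) y.
Proof.
move=> a0 r.
have r2 : r ^+ 2 = a ^+ 2 + b ^+ 2 by rewrite sqr_sqrtr// addr_ge0 ?sqr_ge0.
have D0 : a ^+ 2 + b ^+ 2 != 0.
  by rewrite gt_eqF// ltr_pwDl ?sqr_ge0// exprn_even_gt0.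
have r0 : r != 0 by apply: contra_neq D0; rewrite -r2 => ->; rewrite expr0n.
have peak_ge0 (s : R) : 0 <= s ^+ 2 * pi *+ 2.
  by rewrite mulrn_wge0// mulr_ge0 ?sqr_ge0 ?pi_ge0.
rewrite !normal_pdfE ?oner_neq0 ?mulf_neq0 ?invr_neq0// /normal_peak /normal_fun.
rewrite mulrACA [RHS]mulrACA -!invfM -!sqrtrM//.
rewrite -!expRD; congr (_^-1 * expR _).
  by congr Num.sqrt; field.
rewrite exprMn exprVn r2 subr0; field.
by rewrite D0 a0.
Qed.

(** After Tonelli and [normal_pdf_disintegration], the inner integral over [y] is that of a normal
    density, hence 1; the normal law of scale [r] remains. *)
Lemma normal_convolution (a b C : R) (h : R -> R) : a != 0 -> measurable_fun setT h ->
  (forall x, 0 <= h x <= C) ->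
  (\int[gamma]_y \int[gamma]_x (h (b * y + a * x))%:E =
   \int[gamma]_x (h (Num.sqrt (a ^+ 2 + b ^+ 2) * x))%:E)%E.
Proof.
move=> a0 mh hC; set r := Num.sqrt _.
have r0 : r != 0.
  by rewrite gt_eqF// sqrtr_gt0 ltr_pwDl ?sqr_ge0// exprn_even_gt0.
have hC' x : `|h x| <= C by rewrite ger0_norm; case/andP: (hC x).
have affE m s : s != 0 -> (\int[gamma]_x (h (m + s * x))%:E =
    \int[mu]_x ((h x)%:E * (normal_pdf m s x)%:E))%E.
  move=> s0; rewrite -(integral_normal_prob m s mh hC').
  apply: (@eq_law_integral _ _ _ _ _ gamma (normal_prob m s) _ id h C) => //.
    by apply: measurable_funD => //; exact: measurable_funM.
  by move=> A mA; exact: normal_prob_affine.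
have -> : (\int[gamma]_x (h (r * x))%:E = \int[mu]_z ((h z)%:E * (normal_pdf 0 r z)%:E))%E.
  by rewrite -affE//; apply: eq_integral => x _; rewrite add0r.
pose k (z : measurableTypeR R * measurableTypeR R) : \bar R :=
  (h z.2 * normal_pdf (b * z.1) a z.2)%:E.
have k0 z : (0 <= k z)%E.
  by rewrite lee_fin mulr_ge0 ?normal_pdf_ge0//; case/andP: (hC z.2).
have mk : measurable_fun setT k.
  apply/measurable_EFinP; apply: measurable_funM; first exact: measurableT_comp.
  rewrite (_ : (fun _ => _) = (fun z => normal_pdf 0 a (z.2 - b * z.1))).
    apply: measurableT_comp; first exact: measurable_normal_pdf.
    by apply: measurable_funB => //; exact: measurable_funM.
  by apply/funext => z; rewrite !normal_pdfE// /normal_fun subr0.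
pose F (y : measurableTypeR R) := (\int[mu]_z k (y, z))%E.
have mF : measurable_fun setT F by exact: measurable_fun_fubini_tonelli_F.
have FE y : F y = (\int[gamma]_x (h (b * y + a * x))%:E)%E by rewrite affE.
have F0 y : (0 <= F y)%E by exact: integral_ge0.
(* The bound makes [F] real-valued and bounded, as [integral_normal_prob] requires. *)
have FC y : (F y <= C%:E)%E.
  rewrite FE -[leRHS]mule1 -(@probability_setT _ _ _ gamma) -integral_cst//.
  apply: ge0_le_integral => //.
  - by move=> x _; rewrite lee_fin; case/andP: (hC (b * y + a * x)).
  - apply/measurable_EFinP; apply: measurableT_comp => //.
    by apply: measurable_funD => //; exact: measurable_funM.
  - by move=> x _; rewrite lee_fin; case/andP: (hC (b * y + a * x)).
have Ffin y : F y \is a fin_num by rewrite ge0_fin_numE// (le_lt_trans (FC y)) ?ltry.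
transitivity (\int[gamma]_y (fine (F y))%:E)%E.
  by apply: eq_integral => y _; rewrite fineK// FE.
rewrite (@integral_normal_prob _ _ C (fine \o F)); last 2 first.
- exact: measurableT_comp.
- by move=> y; rewrite /= ger0_norm ?fine_ge0// -lee_fin fineK.
pose l (z : measurableTypeR R * measurableTypeR R) : \bar R := (k z * (normal_pdf 0 1 z.1)%:E)%E.
have l0 z : (0 <= l z)%E by rewrite mule_ge0// lee_fin normal_pdf_ge0.
have ml : measurable_fun setT l.
  apply: emeasurable_funM => //; apply/measurable_EFinP.
  by apply: measurableT_comp => //; exact: measurable_normal_pdf.
transitivity (\int[mu]_y \int[mu]_z l (y, z))%E.
  apply: eq_integral => y _; rewrite /= fineK// /F /l /= ge0_integralZr//.
  - exact: measurableT_comp.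
  - by rewrite lee_fin normal_pdf_ge0.
rewrite (@fubini_tonelli _ _ _ _ _ mu mu l ml l0); apply: eq_integral => z _.
under eq_integral do rewrite /l /k /= -EFinM -mulrA normal_pdf_disintegration// mulrA EFinM.
rewrite ge0_integralZl_EFin//.
- by rewrite integral_normal_pdf mule1 EFinM.
- by move=> y _; rewrite lee_fin normal_pdf_ge0.
- by apply/measurable_EFinP; exact: measurable_normal_pdf.
- by rewrite mulr_ge0 ?normal_pdf_ge0//; case/andP: (hC z).
Qed.

End normal_convolution.

(** * The characteristic function of the standard normal law and its functional equation *)

Section normal_cosine_transform.
Context {R : realType}.
Local Notation gamma := (normal_prob 0 1 : probability (measurableTypeR R) R).

(** The characteristic function, which is real because the law is symmetric. It is handled through
    its value at 0, its evenness and the equation [normal_cos_sqrt]. *)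
Definition normal_cos (t : R) : R := (\int[gamma]_x cos (t * x))%R.

Lemma normal_cos0 : normal_cos 0 = 1 :> R.
Proof.
rewrite /normal_cos; under eq_Rintegral do rewrite mul0r cos0.
by rewrite Rintegral_cst//= probability_setT mul1r.
Qed.

Lemma measurable_cos d (T : measurableType d) (f : T -> R) :
  measurable_fun setT f -> measurable_fun setT (fun w => cos (f w)).
Proof.
by move=> mf; apply: measurableT_comp => //; apply: continuous_measurable_fun; exact: continuous_cos.
Qed.

Lemma integrable_cos d (T : measurableType d) (P : probability T R) (f : T -> R) :
  measurable_fun setT f -> P.-integrable setT (EFin \o (fun w => cos (f w))).
Proof.
by move=> mf; apply: (@integrable_bounded _ _ _ _ _ 1) => [|w]; [exact: measurable_cos|exact: cos_max].
Qed.

Lemma measurable_affine (a b : R) : measurable_fun setT (fun x : R => a * x + b).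
Proof. by apply: measurable_funD => //; exact: measurable_funM. Qed.

Lemma integral_1Dcos d (T : measurableType d) (P : probability T R) (f : T -> R) (k : R) :
  measurable_fun setT f ->
  (\int[P]_w (1 + k * cos (f w))%:E = (1 + k * \int[P]_w cos (f w))%:E)%E.
Proof.
move=> mf; have icos := integrable_cos P mf.
under eq_integral do rewrite EFinD EFinM.
rewrite integralD//; last 2 first.
- exact: finite_measure_integrable_cst.
- exact: integrableZl.
rewrite -[X in (X + _)%E = _]/(\int[P]_w (cst 1%E w))%E integral_cst//=.
rewrite probability_setT mul1e integralZl// EFinD EFinM; congr (_ + _ * _)%E.
by rewrite /Rintegral fineK// integrable_fin_num.
Qed.

Lemma normal_integralN (f : R -> R) (C : R) : measurable_fun setT f ->
  (forall x, `|f x| <= C) ->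
  (\int[gamma]_x (f (- x))%:E = \int[gamma]_x (f x)%:E)%E.
Proof.
move=> mf fC; apply: (@eq_law_integral _ _ _ _ _ gamma gamma (fun x : R => - x) id f C) => //.
  exact: measurable_funN.
by move=> A mA; exact: normal_preimageN.
Qed.

(** By symmetry [c] may be replaced by [- c], and the sum of the two integrands is 2 cos c cos(r
    x). *)
Lemma normal_cos_shift (r c : R) :
  (\int[gamma]_x cos (r * x + c))%R = cos c * normal_cos r.
Proof.
have sym : (\int[gamma]_x cos (r * x + c) = \int[gamma]_x cos (r * x - c))%R.
  rewrite /Rintegral; congr fine.
  rewrite -(@normal_integralN _ 1).
  - by apply: eq_integral => x _; rewrite -cosN; congr (cos _)%:E; ring.
  - by apply: measurable_cos; exact: measurable_affine.
  - by move=> x; exact: cos_max.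
have := RintegralD (mu := gamma) measurableT (integrable_cos gamma (measurable_affine r c))
  (integrable_cos gamma (measurable_affine r (- c))).
rewrite -sym.
have -> : (\int[gamma]_x (cos (r * x + c) + cos (r * x - c)) =
    \int[gamma]_x ((2 * cos c) * cos (r * x)))%R.
  by apply: eq_Rintegral => x _; rewrite !cosD cosN sinN; ring.
rewrite RintegralZl//; last by apply: integrable_cos; exact: measurable_funM.
by rewrite -/(normal_cos r) => h; lra.
Qed.

(** This is [normal_convolution] for the nonnegative function 1 + cos, with the inner integral
    evaluated by [normal_cos_shift]. *)
Lemma normal_cos_sqrt (a b : R) :
  normal_cos (Num.sqrt (a ^+ 2 + b ^+ 2)) = normal_cos a * normal_cos b.
Proof.
(* [normal_convolution] excludes [a = 0], where the identity reduces to the evenness of cosine. *)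
have [->|a0] := eqVneq a 0.
  rewrite expr0n add0r sqrtr_sqr.
  rewrite normal_cos0 mul1r /normal_cos; apply: eq_Rintegral => x _.
  by case: (ger0P b) => // _; rewrite mulNr cosN.
have mc : measurable_fun setT (fun x => 1 + cos x : R).
  by apply: measurable_funD => //; exact: measurable_cos.
have cbd (x : R) : 0 <= 1 + cos x <= 2.
  by apply/andP; split; [have := cos_geN1 x|have := cos_le1 x]; lra.
have := normal_convolution b a0 mc cbd.
have mM k : measurable_fun setT (fun x : R => k * x) by exact: measurable_funM.
have -> : (\int[gamma]_x (1 + cos (Num.sqrt (a ^+ 2 + b ^+ 2) * x))%:E =
    (1 + normal_cos (Num.sqrt (a ^+ 2 + b ^+ 2)))%:E)%E.
  rewrite -[normal_cos _]mul1r -integral_1Dcos//.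
  by apply: eq_integral => x _; rewrite mul1r.
under eq_integral => y _.
  rewrite (_ : integral _ _ _ = (1 + normal_cos a * cos (b * y))%:E); last first.
    rewrite [normal_cos a * _]mulrC -normal_cos_shift -[Rintegral _ _ _]mul1r -integral_1Dcos.
      by apply: eq_integral => x _; rewrite mul1r [b * y + _]addrC.
    exact: measurable_affine.
  over.
by rewrite integral_1Dcos// => -[] /addrI.
Qed.

End normal_cosine_transform.

(** The shape is that of the product-to-sum formula for cosines used below, with nonnegativity in
    place of integrability. *)
Lemma ge0_integral_combination d (T : measurableType d) (R : realType)
    (m : {measure set T -> \bar R}) (f1 f2 f3 f4 : T -> \bar R) (k : R) : 0 <= k ->
  measurable_fun setT f1 -> measurable_fun setT f2 ->
  measurable_fun setT f3 -> measurable_fun setT f4 ->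
  (forall w, 0 <= f1 w)%E -> (forall w, 0 <= f2 w)%E ->
  (forall w, 0 <= f3 w)%E -> (forall w, 0 <= f4 w)%E ->
  (\int[m]_w (f1 w + f2 w + k%:E * (f3 w + f4 w)) =
   \int[m]_w f1 w + \int[m]_w f2 w + k%:E * (\int[m]_w f3 w + \int[m]_w f4 w))%E.
Proof.
move=> k0 m1 m2 m3 m4 p1 p2 p3 p4.
have m12 : measurable_fun setT (fun w => f1 w + f2 w)%E by exact: emeasurable_funD.
have m34 : measurable_fun setT (fun w => f3 w + f4 w)%E by exact: emeasurable_funD.
have p12 w : [set: T] w -> (0 <= f1 w + f2 w)%E by rewrite adde_ge0.
have p34 w : [set: T] w -> (0 <= f3 w + f4 w)%E by rewrite adde_ge0.
have mk : measurable_fun setT (fun w => k%:E * (f3 w + f4 w))%E.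
  by apply: emeasurable_funM.
have pk w : [set: T] w -> (0 <= k%:E * (f3 w + f4 w))%E by move=> ?; rewrite mule_ge0 ?p34.
by rewrite (ge0_integralD m measurableT p12 m12 pk mk)
  (ge0_integralZl_EFin m measurableT p34 m34 k0) !ge0_integralD.
Qed.

(** * Independence from the laws of all linear combinations *)

Section independent_pair.
Context d (T : measurableType d) (R : realType) (P : probability T R).
Variables U V : T -> R.
Hypotheses (mU : measurable_fun setT U) (mV : measurable_fun setT V).

(** A product measure is determined by its values on rectangles, so the joint law is the product
    law, which is then evaluated by sections. *)
Lemma independent_pair_law (E : set (measurableTypeR R * measurableTypeR R)) :
  (forall A B, measurable A -> measurable B ->
    P (U @^-1` A `&` V @^-1` B) = (P (U @^-1` A) * P (V @^-1` B))%E) ->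
  measurable E ->
  P ((fun w => (U w, V w)) @^-1` E) = (\int[P]_w P (V @^-1` xsection E (U w)))%E.
Proof.
move=> indep mE.
pose X : {mfun T >-> measurableTypeR R} := HB.pack (U : T -> measurableTypeR R)
  (isMeasurableFun.Build _ _ T (measurableTypeR R) U mU).
pose Y : {mfun T >-> measurableTypeR R} := HB.pack (V : T -> measurableTypeR R)
  (isMeasurableFun.Build _ _ T (measurableTypeR R) V mV).
have mXY : measurable_fun setT (fun w => (X w, Y w)) by exact/measurable_fun_pairP.
pose Z : {mfun T >-> (measurableTypeR R * measurableTypeR R)%type} :=
  HB.pack (fun w => (X w, Y w)) (isMeasurableFun.Build _ _ T
    (measurableTypeR R * measurableTypeR R)%type _ mXY).
have := @product_measure_unique _ _ _ _ R (distribution P X) (distribution P Y)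
  (distribution P Z) _ E mE.
rewrite -[P _]/(distribution P Z E) => <-; last by move=> A B mA mB; exact: indep.
rewrite [LHS]ge0_integral_distribution//.
exact: (@measurable_fun_xsection _ _ _ _ R (distribution P Y)).
Qed.

End independent_pair.

Section gaussian_independence.
Context d (T : measurableType d) (R : realType) (P : probability T R).
Local Notation gamma := (normal_prob 0 1 : probability (measurableTypeR R) R).
Variables (U V : T -> R) (s t : R).
Hypotheses (mU : measurable_fun setT U) (mV : measurable_fun setT V).
Hypothesis UVlaw : forall a b A, measurable A ->
  P ((fun w => a * U w + b * V w) @^-1` A) =
  gamma ((fun x => Num.sqrt ((a * s) ^+ 2 + (b * t) ^+ 2) * x) @^-1` A).

Let mUV a b : measurable_fun setT (fun w => a * U w + b * V w).
Proof. by apply: measurable_funD; exact: measurable_funM. Qed.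

Let mUVc a b c : measurable_fun setT (fun w => a * U w + b * V w + c).
Proof. exact: measurable_funD. Qed.

(** The combination is a centered normal variable whose scale is the root of a sum of squares, and
    [normal_cos_sqrt] turns that root into a product. *)
Lemma expectation_cos_combination (a b c : R) :
  (\int[P]_w cos (a * U w + b * V w + c))%R =
  cos c * (normal_cos (a * s) * normal_cos (b * t)).
Proof.
rewrite -normal_cos_sqrt -normal_cos_shift /Rintegral; congr fine.
apply: (@eq_law_integral _ _ _ _ _ P gamma _ (fun x => Num.sqrt ((a * s) ^+ 2 + (b * t) ^+ 2) * x)
  (fun x => cos (x + c)) 1) => //.
- exact: measurable_funM.
- by move=> A mA; exact: UVlaw.
- by apply: measurable_cos; exact: measurable_funD.
- by move=> x; exact: cos_max.
Qed.

Let integral_1Dcos_combination (a b c : R) :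
  (\int[P]_w (1 + cos (a * U w + b * V w + c))%:E =
   (1 + cos c * (normal_cos (a * s) * normal_cos (b * t)))%:E)%E.
Proof.
rewrite -expectation_cos_combination -[Rintegral _ _ _]mul1r -integral_1Dcos//.
by apply: eq_integral => w _; rewrite mul1r.
Qed.

Let integral_cosV (b c : R) :
  (\int[P]_w (1 + cos (b * V w + c))%:E = (1 + cos c * normal_cos (b * t))%:E)%E.
Proof.
have := integral_1Dcos_combination 0 b c; rewrite mul0r normal_cos0 mul1r => <-.
by apply: eq_integral => w _; rewrite mul0r add0r.
Qed.

Let bnd (x : R) : 0 <= 1 + cos x <= 2.
Proof. by apply/andP; split; [have := cos_geN1 x|have := cos_le1 x]; lra. Qed.

Let mVc b c : measurable_fun setT (fun w => 1 + cos (b * V w + c)).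
Proof.
apply: measurable_funD => //; apply: measurable_cos.
by apply: measurable_funD => //; exact: measurable_funM.
Qed.

Let cosV_bnd (b c : R) : 0 <= 1 + cos c * normal_cos (b * t) <= 2.
Proof.
rewrite -!lee_fin -integral_cosV; apply/andP; split.
  by apply: integral_ge0 => w _; rewrite lee_fin; case/andP: (bnd (b * V w + c)).
rewrite -[leRHS]mule1 -(@probability_setT _ _ _ P) -integral_cst//.
apply: ge0_le_integral => //.
- exact/measurable_EFinP.
- by move=> w _; rewrite lee_fin; case/andP: (bnd (b * V w + c)).
Qed.

(** As weights for the law of [U], the function 1 + cos(b V + c) and its constant mean have the same
    cosine transform, so [cos_transform_inj] identifies the two weighted laws. *)
Let integral_1Dcos_indep (b c : R) A : measurable A ->
  (\int[P]_(w in U @^-1` A) (1 + cos (b * V w + c))%:E =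
   (1 + cos c * normal_cos (b * t))%:E * P (U @^-1` A))%E.
Proof.
move=> mA; have mUA : measurable (U @^-1` A) by rewrite -[X in measurable X]setTI; exact: mU.
rewrite -integral_cst//.
apply: (@cos_transform_inj _ _ _ P U mU _ (cst (1 + cos c * normal_cos (b * t))) 2) => //.
  by move=> w; exact: cosV_bnd.
move=> r u.
have mUu : measurable_fun setT (fun w => r * (U w - u)).
  by apply: measurable_funM => //; exact: measurable_funB.
have mVc' : measurable_fun setT (fun w => b * V w + c).
  by apply: measurable_funD => //; exact: measurable_funM.
have -> : (\int[P]_w (cst (1 + cos c * normal_cos (b * t)) w * (1 + cos (r * (U w - u))))%:E =
    ((1 + cos c * normal_cos (b * t)) * (1 + cos (r * u) * normal_cos (r * s)))%:E)%E.
  under eq_integral do rewrite EFinM.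
  rewrite ge0_integralZl_EFin//.
  - rewrite EFinM; congr (_ * _)%E.
    have := integral_1Dcos_combination r 0 (- (r * u)).
    rewrite mul0r normal_cos0 mulr1 cosN => <-.
    by apply: eq_integral => w _; congr (1 + cos _)%:E; ring.
  - by apply/measurable_EFinP; apply: measurable_funD => //; exact: measurable_cos.
  - by case/andP: (cosV_bnd b c).
(* From 2 cos x cos y = cos(x + y) + cos(x - y). Adding 2 leaves only terms 1 + cos on the right,
   which are nonnegative and have known integrals. *)
have E (w : T) : (1 + cos (b * V w + c)) * (1 + cos (r * (U w - u))) + 2 =
  (1 + cos (0 * U w + b * V w + c)) + (1 + cos (r * U w + 0 * V w + - (r * u))) +
  2^-1 * ((1 + cos (r * U w + b * V w + (c - r * u))) +
   (1 + cos (r * U w + (- b) * V w + (- c - r * u)))).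
  have -> : r * U w + b * V w + (c - r * u) = (b * V w + c) + r * (U w - u) by ring.
  have -> : r * U w + (- b) * V w + (- c - r * u) = r * (U w - u) - (b * V w + c) by ring.
  rewrite mul0r add0r mul0r addr0 (_ : r * U w + - (r * u) = r * (U w - u)); last by ring.
  by move: (b * V w + c) (r * (U w - u)) => x y; rewrite cosD cosB; field.
have ge01 x : (0 <= (1 + cos x)%:E :> \bar R)%E by rewrite lee_fin; case/andP: (bnd x).
have mcos a' b' c' : measurable_fun setT (fun w => (1 + cos (a' * U w + b' * V w + c'))%:E).
  by apply/measurable_EFinP; apply: measurable_funD => //; exact: measurable_cos.
have : (\int[P]_w ((1 + cos (b * V w + c)) * (1 + cos (r * (U w - u))))%:E + 2%:E =
    (((1 + cos c * normal_cos (b * t)) * (1 + cos (r * u) * normal_cos (r * s))) + 2)%:E)%E.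
  have -> : 2%:E = (\int[P]_w cst 2%:E w)%E.
    by rewrite integral_cst//= probability_setT mule1.
  rewrite -ge0_integralD//; first last.
  - by move=> w _; rewrite /= lee_fin.
  - apply/measurable_EFinP; apply: measurable_funM => //.
    by apply: measurable_funD => //; exact: measurable_cos.
  pose g a' b' c' w := (1 + cos (a' * U w + b' * V w + c'))%:E.
  transitivity (\int[P]_w (g 0%R b c w + g r 0%R (- (r * u))%R w +
      (2^-1)%:E * (g r b (c - r * u)%R w + g r (- b)%R (- c - r * u)%R w)))%E.
    by apply: eq_integral => w _; rewrite /= -EFinD E.
  rewrite ge0_integral_combination//; first last.
  1-4: by move=> w; exact: ge01.
  1-4: exact: mcos.
  rewrite !integral_1Dcos_combination -!EFinD; congr EFin.
  rewrite !mul0r normal_cos0 !cosB !cosN !sinN (_ : normal_cos (- b * t) = normal_cos (b * t)).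
    by field.
  by apply: eq_Rintegral => x _; rewrite !mulNr cosN.
move=> /(congr1 (fun x => x - 2%:E)%E); rewrite !addeK// => ->.
by rewrite -EFinB addrK.
Qed.

(** A second use of [cos_transform_inj], now for the law of [V]: the indicator of the event that [U]
    lies in [A] and the constant probability of this event have the same cosine transform by
    [integral_1Dcos_indep]. *)
Lemma gaussian_independent A B : measurable A -> measurable B ->
  P (U @^-1` A `&` V @^-1` B) = (P (U @^-1` A) * P (V @^-1` B))%E.
Proof.
move=> mA mB.
have mUA : measurable (U @^-1` A) by rewrite -[X in measurable X]setTI; exact: mU.
have mVB : measurable (V @^-1` B) by rewrite -[X in measurable X]setTI; exact: mV.
have Pfin : P (U @^-1` A) \is a fin_num by exact: fin_num_measure.
have mI : measurable_fun setT (\1_(U @^-1` A) : T -> R) by exact: measurable_indic.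
have p01 : 0 <= fine (P (U @^-1` A)) <= 1.
  by rewrite fine_ge0//= -lee_fin fineK// probability_le1.
suff h : (\int[P]_(w in V @^-1` B) (\1_(U @^-1` A) w : R)%:E =
    \int[P]_(w in V @^-1` B) (cst (fine (P (U @^-1` A))) w)%:E)%E.
  move: h; rewrite integral_indic//= => ->.
  under eq_integral do rewrite fineK//.
  by rewrite integral_cst.
apply: (@cos_transform_inj _ _ _ P V mV _ _ 1) => //.
  by move=> w; rewrite indicE; case: (_ \in _); rewrite ?lexx ler01.
move=> r v; rewrite /=.
have := integral_1Dcos_indep r (- (r * v)) mA; rewrite -integral_cosV => h.
transitivity (\int[P]_(w in U @^-1` A) (1 + cos (r * V w + - (r * v)))%:E)%E.
  rewrite [RHS]integral_mkcond; apply: eq_integral => w _; rewrite epatch_indic /= EFinM muleC.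
  by rewrite mulrBr.
rewrite h muleC -[in LHS](fineK Pfin) -ge0_integralZl_EFin//.
- by apply: eq_integral => w _; rewrite EFinM mulrBr.
- exact/measurable_EFinP.
- by rewrite fine_ge0.
Qed.

End gaussian_independence.

(** * Linear combinations of the process *)

Section second_moments.
Context {R : realType}.
Local Notation gamma := (normal_prob 0 1 : probability (measurableTypeR R) R).

(** An extended real until its finiteness is established in [kappaP]. *)
Definition normal_second_moment : \bar R := (\int[gamma]_x (x ^+ 2)%:E)%E.

(** The scales [s] and [- s] give the same integral by symmetry, and adding the two cancels the
    cross term without a first moment. *)
Lemma normal_affine_second_moment (m s : R) :
  (\int[gamma]_x ((m + s * x) ^+ 2)%:E =
   (m ^+ 2)%:E + (s ^+ 2)%:E * normal_second_moment)%E.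
Proof.
have msq (a b : R) : measurable_fun setT (fun x : R => (a + b * x) ^+ 2).
  by apply: measurable_funX; apply: measurable_funD => //; exact: measurable_funM.
pose I := (\int[gamma]_x ((m + s * x) ^+ 2)%:E)%E; rewrite -/I.
have sq0 (f : R -> R) (x : R) : [set: R] x -> (0 <= (f x ^+ 2)%:E)%E.
  by move=> _; rewrite lee_fin sqr_ge0.
have IN : (\int[gamma]_x ((m + - s * x) ^+ 2)%:E)%E = I.
  rewrite /I -(@ge0_eq_law_integral _ _ _ _ _ gamma gamma (fun x : R => - x) id
    (fun x => (m + s * x) ^+ 2))//.
  - by apply: eq_integral => x _; rewrite mulrN mulNr.
  - exact: measurable_funN.
  - by move=> A mA; rewrite normal_preimageN.
  - by move=> x; exact: sqr_ge0.
have mE a b : measurable_fun setT (fun x : R => ((a + b * x) ^+ 2)%:E) by exact/measurable_EFinP.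
have mx : measurable_fun setT (fun x : R => (x ^+ 2)%:E).
  by apply/measurable_EFinP; exact: measurable_funX.
have : (I + I = 2%:E * ((m ^+ 2)%:E + (s ^+ 2)%:E * normal_second_moment))%E.
  rewrite -{2}IN -(ge0_integralD gamma measurableT (sq0 _) (mE m s) (sq0 _) (mE m (- s))).
  transitivity (\int[gamma]_x (cst (2 * m ^+ 2)%:E x + (2 * s ^+ 2)%:E * (x ^+ 2)%:E))%E.
    by apply: eq_integral => x _; rewrite -EFinD -EFinM -EFinD; congr EFin; ring.
  have c0 x : [set: R] x -> (0 <= cst (2 * m ^+ 2)%:E x)%E.
    by move=> _; rewrite lee_fin mulr_ge0 ?sqr_ge0.
  have k0 x : [set: R] x -> (0 <= (2 * s ^+ 2)%:E * (x ^+ 2)%:E)%E.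
    by move=> _; rewrite -EFinM lee_fin mulr_ge0 ?sqr_ge0// mulr_ge0 ?sqr_ge0.
  have mk : measurable_fun setT (fun x : R => (2 * s ^+ 2)%:E * (x ^+ 2)%:E)%E.
    exact: emeasurable_funM.
  have s20 : 0 <= 2 * s ^+ 2 by rewrite mulr_ge0 ?sqr_ge0.
  rewrite (ge0_integralD gamma measurableT c0 (measurable_cst _) k0 mk).
  have x20 (x : R) : [set: R] x -> (0 <= (x ^+ 2)%:E)%E by move=> _; rewrite lee_fin sqr_ge0.
  rewrite (ge0_integralZl_EFin gamma measurableT x20 mx s20).
  rewrite integral_cst//= probability_setT mule1.
  have K0 : (0 <= normal_second_moment)%E by apply: integral_ge0 => x _; rewrite lee_fin sqr_ge0.
  rewrite -/normal_second_moment [RHS]ge0_muleDr ?mule_ge0 ?lee_fin ?sqr_ge0//.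
  by rewrite [in RHS]muleA -[in RHS]EFinM -[in RHS]EFinM.
move=> h; have : ((2^-1)%:E * (I + I) = I)%E.
  by rewrite -mule2n -mule_natl muleA -EFinM mulVf// mul1e.
by rewrite h muleA -EFinM mulVf// mul1e.
Qed.

End second_moments.

(** * Variances and laws of finite combinations of the process *)

Section linear_combinations.
Context {R : realType} {d : measure_display} {Omega : measurableType d}
  (P : probability Omega R) (X : set R -> Omega -> R).
Hypothesis hX : gaussian_partial_information P X.
Local Notation gamma := (normal_prob 0 1 : probability (measurableTypeR R) R).
Local Notation mu := (@lebesgue_measure R).

Lemma unit_borelI B B' : unit_borel B -> unit_borel B' -> unit_borel (B `&` B' : set R).
Proof.
by move=> [mB B01] [mB' _]; split; [exact: measurableI|move=> x [/B01]].
Qed.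

Lemma unit_borel_le1 (B : set R) : unit_borel B -> (mu B <= 1)%E.
Proof.
move=> [mB B01]; apply: (@le_trans _ _ (mu `[0%R, 1%R])).
  by apply: le_measure; rewrite ?inE.
by rewrite lebesgue_measure_itv/= lte_fin ltr01 oppr0 adde0.
Qed.

Lemma unit_borel_fin_num (B : set R) : unit_borel B -> mu B \is a fin_num.
Proof. by move=> uB; rewrite ge0_fin_numE// (le_lt_trans (unit_borel_le1 uB)) ?ltry. Qed.

Let gauss_comb n (t : 'I_n -> set R) (c : 'I_n -> R) : (forall k, unit_borel (t k)) ->
  measurable_fun setT (fun w => \sum_(k < n) c k * X (t k) w) /\
  exists m s, 0 <= s /\ forall A, measurable A ->
    P ((fun w => \sum_(k < n) c k * X (t k) w) @^-1` A) = gamma ((fun x => m + s * x) @^-1` A).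
Proof.
move=> ut; have [+ _ _] := hX => /(_ n t c ut)[m [s [s0 [mL LE]]]].
split => //; exists m, s; split => // A mA.
by rewrite LE// gaussian_lawE.
Qed.

Lemma measurable_process B : unit_borel B -> measurable_fun setT (X B).
Proof.
move=> uB; have [+ _] := @gauss_comb 1 (fun=> B) (fun=> 1) (fun=> uB).
by under eq_fun do rewrite big_ord1 mul1r.
Qed.

Let expectation0 B : unit_borel B -> (\int[P]_w (X B w)%:E = 0)%E.
Proof. by move=> uB; have [_ + _] := hX => /(_ B uB); rewrite unlock. Qed.

Let expectationM B B' : unit_borel B -> unit_borel B' ->
  (\int[P]_w (X B w * X B' w)%:E = mu (B `&` B'))%E.
Proof.
move=> uB uB'; have [_ _ /(_ B B' uB uB') <-] := hX.
rewrite unlock [in RHS]unlock.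
apply: eq_integral => w _; rewrite !fctE/= !expectation0//= !subr0.
by [].
Qed.

Let integrable_sqr B : unit_borel B -> P.-integrable setT (fun w => (X B w ^+ 2)%:E).
Proof.
move=> uB; apply/integrableP; split.
  by apply/measurable_EFinP; apply: measurable_funX; exact: measurable_process.
under eq_integral do rewrite gee0_abs ?lee_fin ?sqr_ge0// expr2.
by rewrite expectationM// setIid -ge0_fin_numE// unit_borel_fin_num.
Qed.

Let integrableM B B' : unit_borel B -> unit_borel B' ->
  P.-integrable setT (fun w => (X B w * X B' w)%:E).
Proof.
move=> uB uB'.
have : P.-integrable setT (fun w => (X B w ^+ 2)%:E + (X B' w ^+ 2)%:E)%E.
  by apply: integrableD => //; exact: integrable_sqr.
apply: le_integrable => //.
  by apply/measurable_EFinP; apply: measurable_funM; exact: measurable_process.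
move=> w _; rewrite /= lee_fin [leRHS]ger0_norm ?addr_ge0 ?sqr_ge0//.
rewrite ler_norml; move: (X B w) (X B' w) => x y; apply/andP; split; nra.
Qed.

Let integrable1 B : unit_borel B -> P.-integrable setT (fun w => (X B w)%:E).
Proof.
move=> uB.
have : P.-integrable setT (fun w => (X B w ^+ 2)%:E + (cst 1%:E) w)%E.
  by apply: integrableD => //; [exact: integrable_sqr|exact: finite_measure_integrable_cst].
apply: le_integrable => //.
  by apply/measurable_EFinP; exact: measurable_process.
move=> w _; rewrite /= lee_fin [leRHS]ger0_norm ?addr_ge0 ?sqr_ge0//.
rewrite ler_norml; move: (X B w) => x; apply/andP; split; nra.
Qed.

Let integrableZ (f : Omega -> R) (k : R) : P.-integrable setT (fun w => (f w)%:E) ->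
  P.-integrable setT (fun w => (k * f w)%:E).
Proof. by move=> h; exact: (integrableZl measurableT k h). Qed.

Definition lincomb n (t : 'I_n -> set R) (c : 'I_n -> R) (w : Omega) : R :=
  \sum_(k < n) c k * X (t k) w.

Definition lincov n (t : 'I_n -> set R) (c c' : 'I_n -> R) : R :=
  \sum_(i < n) \sum_(j < n) c i * c' j * fine (mu (t i `&` t j)).

Lemma measurable_lincomb n (t : 'I_n -> set R) c : (forall k, unit_borel (t k)) ->
  measurable_fun setT (lincomb t c).
Proof. by move=> ut; case: (gauss_comb c ut). Qed.

(** The free shift [e] allows the mean of the normal law to be read off from second moments. *)
Let lincomb_shift_second_moment n (t : 'I_n -> set R) c e : (forall k, unit_borel (t k)) ->
  (\int[P]_w ((e + lincomb t c w) ^+ 2)%:E = (e ^+ 2 + lincov t c c)%:E)%E.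
Proof.
move=> ut.
have i1 : P.-integrable setT (fun w => \sum_(k < n) (c k * X (t k) w)%:E)%E.
  by apply: integrable_sum => // k _; apply: integrableZ; exact: integrable1.
have i2 i : P.-integrable setT (fun w => \sum_(j < n) (c i * c j * (X (t i) w * X (t j) w))%:E)%E.
  by apply: integrable_sum => // k _; apply: integrableZ; exact: integrableM.
transitivity (\int[P]_w ((e ^+ 2)%:E + (2 * e)%:E * \sum_(k < n) (c k * X (t k) w)%:E +
    \sum_(i < n) \sum_(j < n) (c i * c j * (X (t i) w * X (t j) w))%:E))%E.
  apply: eq_integral => w _.
  under [X in (_ = _ + X)%E]eq_bigr do rewrite sumEFin.
  rewrite !sumEFin -EFinM -!EFinD; congr EFin.
  rewrite sqrrD -mulr_natl mulrA; congr (_ + _ + _).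
  rewrite expr2 /lincomb mulr_suml; apply: eq_bigr => i _.
  by rewrite mulr_sumr; apply: eq_bigr => j _; rewrite mulrACA.
have i3 : P.-integrable setT (fun w => (e ^+ 2)%:E + (2 * e)%:E * \sum_(k < n) (c k * X (t k) w)%:E)%E.
  by apply: integrableD => //; [exact: finite_measure_integrable_cst|exact: integrableZl].
rewrite integralD//; last by apply: integrable_sum => // i _; exact: i2.
rewrite integralD//; [|exact: finite_measure_integrable_cst|exact: integrableZl].
rewrite integral_cst//= probability_setT mule1 integralZl// integral_sum//; last first.
  by move=> k; apply: integrableZ; exact: integrable1.
rewrite [X in (_ + _ * X + _)%E]big1 ?mule0 ?adde0; last first.
  move=> k _; under eq_integral do rewrite EFinM.
  by rewrite integralZl ?expectation0 ?mule0//; exact: integrable1.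
rewrite EFinD integral_sum//; congr (_ + _)%E.
rewrite -sumEFin; apply: eq_bigr => i _; rewrite integral_sum//; last first.
  by move=> k; apply: integrableZ; exact: integrableM.
rewrite -sumEFin; apply: eq_bigr => j _; under eq_integral do rewrite EFinM.
rewrite integralZl//; last exact: integrableM.
by rewrite expectationM// [RHS]EFinM fineK// unit_borel_fin_num//; exact: unit_borelI.
Qed.

Definition kappa : R := fine (@normal_second_moment R).

Let unit_interval : unit_borel (`[0, 1]%classic : set R).
Proof. by split; [exact: measurable_itv|]. Qed.

(** The second moment of [e + lincomb t c], computed from the covariances and from the normal law,
    gives two expressions equal for all [e]; they force the mean to vanish and fix the variance. *)
Let comb_law n (t : 'I_n -> set R) c : (forall k, unit_borel (t k)) ->
  exists s, [/\ 0 <= s, ((s ^+ 2)%:E * normal_second_moment = (lincov t c c)%:E)%E &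
    forall A, measurable A -> P (lincomb t c @^-1` A) = gamma ((fun x => s * x) @^-1` A)].
Proof.
move=> ut; have [mL [m [s [s0 LE]]]] := gauss_comb c ut.
have M e : ((e ^+ 2 + lincov t c c)%:E = ((e + m) ^+ 2)%:E + (s ^+ 2)%:E * normal_second_moment)%E.
  rewrite -lincomb_shift_second_moment// -normal_affine_second_moment.
  rewrite (@ge0_eq_law_integral _ _ _ _ _ P gamma (lincomb t c) (fun x => m + s * x)
    (fun x => (e + x) ^+ 2))//.
  - by apply: eq_integral => x _; rewrite addrA.
  - by apply: measurable_funD => //; exact: measurable_funM.
  - by apply: measurable_funX; exact: measurable_funD.
  - by move=> x; exact: sqr_ge0.
have Kfin : ((s ^+ 2)%:E * @normal_second_moment R)%E \is a fin_num.
  have := M 0; case: (_ * _)%E => //=; by rewrite ?addey ?addeNy.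
move: M Kfin; case EQ : ((s ^+ 2)%:E * _)%E => [k||] //= M _.
(* The difference of the cases [e = 1] and [e = 0] reads 1 = 1 + 2 m. *)
have m0 : m = 0.
  by have := M 0; have := M 1; rewrite -!EFinD => -[] h1 -[] h0; nra.
exists s; split => //.
  by rewrite EQ; have := M 0; rewrite m0 addr0 expr0n/= add0e add0r => ->.
by move=> A mA; rewrite LE//; under eq_fun do rewrite m0 add0r.
Qed.

(** The variance of X_S is 1, so a square times the second moment is 1 in the extended reals; this
    excludes both 0 and infinity. *)
Let kappaP : normal_second_moment = kappa%:E /\ 0 < kappa.
Proof.
have [s [s0 + _]] := @comb_law 1 (fun=> `[0, 1]%classic) (fun=> 1) (fun=> unit_interval).
rewrite /lincov !big_ord1 !mul1r setIid lebesgue_measure_itv/= lte_fin ltr01 oppr0 adde0 /kappa.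
have : (0 <= @normal_second_moment R)%E.
  by apply: integral_ge0 => x _; rewrite lee_fin sqr_ge0.
case: normal_second_moment => //=.
- move=> k; rewrite lee_fin => k0; rewrite -EFinM => -[] h; split => //.
  by rewrite lt_neqAle k0 andbT eq_sym; apply: contra_eqN h => /eqP ->; rewrite mulr0 eq_sym oner_neq0.
- move=> _; have [->|s_neq0] := eqVneq s 0; first by rewrite expr0n mul0e => -[] /eqP; rewrite eq_sym oner_eq0.
  by rewrite gt0_muley ?lte_fin ?exprn_even_gt0.
Qed.

Lemma kappa_gt0 : 0 < kappa. Proof. by case: kappaP. Qed.

Lemma lincov_ge0 n (t : 'I_n -> set R) c : (forall k, unit_borel (t k)) -> 0 <= lincov t c c.
Proof.
move=> ut; have [s [_ + _]] := comb_law c ut; have [-> k0] := kappaP.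
by rewrite -EFinM => -[] <-; rewrite mulr_ge0 ?sqr_ge0// ltW.
Qed.

Lemma lincomb_law n (t : 'I_n -> set R) c A : (forall k, unit_borel (t k)) ->
  measurable A ->
  P (lincomb t c @^-1` A) = gamma ((fun x => Num.sqrt (lincov t c c / kappa) * x) @^-1` A).
Proof.
move=> ut mA; have [s [s0 + LE]] := comb_law c ut.
have [-> k0] := kappaP; rewrite -EFinM => -[] <-.
by rewrite LE// mulfK ?gt_eqF// sqrtr_sqr ger0_norm.
Qed.

End linear_combinations.

(** * Joint laws of uncorrelated combinations *)

Section joint_law.
Context {R : realType} {d : measure_display} {Omega : measurableType d}
  (P : probability Omega R) (X : set R -> Omega -> R).
Hypothesis hX : gaussian_partial_information P X.
Local Notation gamma := (normal_prob 0 1 : probability (measurableTypeR R) R).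
Local Notation kappa := (@kappa R).

Lemma lincombD n (t : 'I_n -> set R) (u v : 'I_n -> R) (a b : R) w :
  a * lincomb X t u w + b * lincomb X t v w = lincomb X t (fun k => a * u k + b * v k) w.
Proof.
rewrite /lincomb !mulr_sumr -big_split/=; apply: eq_bigr => k _; ring.
Qed.

Lemma lincovC n (t : 'I_n -> set R) (u v : 'I_n -> R) : lincov t u v = lincov t v u.
Proof.
rewrite /lincov exchange_big/=; apply: eq_bigr => i _; apply: eq_bigr => j _.
by rewrite setIC mulrC [u _ * _]mulrC mulrC.
Qed.

Lemma lincovD n (t : 'I_n -> set R) (u v : 'I_n -> R) (a b : R) :
  lincov t (fun k => a * u k + b * v k) (fun k => a * u k + b * v k) =
  a ^+ 2 * lincov t u u + 2 * a * b * lincov t u v + b ^+ 2 * lincov t v v.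
Proof.
have -> : 2 * a * b * lincov t u v = a * b * lincov t u v + a * b * lincov t v u.
  by rewrite [lincov t v u]lincovC; ring.
rewrite /lincov !mulr_sumr -!big_split/=; apply: eq_bigr => i _.
rewrite !mulr_sumr -!big_split/=; apply: eq_bigr => j _; ring.
Qed.

(** With zero covariance, a combination of the two has as variance the sum of squares that
    [gaussian_independent] asks for. *)
Lemma lincomb_independent n (t : 'I_n -> set R) (u v : 'I_n -> R) A B :
  (forall k, unit_borel (t k)) -> lincov t u v = 0 -> measurable A -> measurable B ->
  P (lincomb X t u @^-1` A `&` lincomb X t v @^-1` B) =
  (P (lincomb X t u @^-1` A) * P (lincomb X t v @^-1` B))%E.
Proof.
move=> ut uv0 mA mB.
apply: (@gaussian_independent _ _ _ P _ _ (Num.sqrt (lincov t u u / kappa))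
  (Num.sqrt (lincov t v v / kappa))) => //.
  exact: (measurable_lincomb hX).
  exact: (measurable_lincomb hX).
move=> a b C mC.
have -> : (fun w => a * lincomb X t u w + b * lincomb X t v w) =
    lincomb X t (fun k => a * u k + b * v k) by apply/funext => w; rewrite lincombD.
have k0 := kappa_gt0 hX.
rewrite (lincomb_law hX)// lincovD uv0 mulr0 addr0 !exprMn !sqr_sqrtr ?divr_ge0 ?(lincov_ge0 hX)// 1?ltW//.
by rewrite !mulrA -mulrDl.
Qed.

Lemma lincomb_joint_law n (t : 'I_n -> set R) (u v : 'I_n -> R)
    (E : set (measurableTypeR R * measurableTypeR R)) :
  (forall k, unit_borel (t k)) -> lincov t u v = 0 -> measurable E ->
  P ((fun w => (lincomb X t u w, lincomb X t v w)) @^-1` E) =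
  (\int[P]_w gamma ((fun x => Num.sqrt (lincov t v v / kappa) * x)%R @^-1`
     xsection E (lincomb X t u w)))%E.
Proof.
move=> ut uv0 mE.
rewrite (@independent_pair_law _ _ _ P _ _ (measurable_lincomb hX _ ut) (measurable_lincomb hX _ ut))//.
  apply: eq_integral => w _; apply: (lincomb_law hX) => //.
  exact: measurable_xsection.
by move=> A B mA mB; exact: lincomb_independent.
Qed.

End joint_law.

(** * Forecasts *)

Section standard_cdf.
Context {R : realType}.
Local Notation gamma := (normal_prob 0 1 : probability (measurableTypeR R) R).
Local Notation mu := (@lebesgue_measure R).

Lemma PhiE (x : R) : (Phi x)%:E = gamma `]-oo, x]%classic.
Proof. by rewrite /Phi fineK// fin_num_measure. Qed.

Lemma Phi_itv (x y : R) : x <= y -> (Phi y - Phi x)%:E = gamma `]x, y]%classic.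
Proof.
move=> xy; rewrite EFinB !PhiE.
have -> : `]-oo, y]%classic = `]-oo, x]%classic `|` `]x, y]%classic :> set R.
  apply/seteqP; split => z /=; rewrite !in_itv/=.
    by move=> zy; have [zx|xz] := leP z x; [left|right].
  by move=> [zx|/andP[]//]; exact: le_trans zx xy.
rewrite measureU//; last first.
  by apply/seteqP; split => // z /=; rewrite !in_itv/= => -[zx /andP[]]; rewrite ltNge zx.
by rewrite addeAC subee ?add0e// fin_num_measure.
Qed.

Lemma Phi_lipschitz (x y : R) : x <= y -> 0 <= Phi y - Phi x <= normal_peak 1 * (y - x).
Proof.
move=> xy; rewrite -!lee_fin Phi_itv// measure_ge0/= /normal_prob.
apply: (@le_trans _ _ (\int[mu]_(z in `]x, y]) (normal_peak 1)%:E)%E).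
  apply: ge0_le_integral => //.
  - by move=> z _; rewrite lee_fin normal_pdf_ge0.
  - by apply: measurable_funTS; apply/measurable_EFinP; exact: measurable_normal_pdf.
  - by move=> z _; rewrite lee_fin; apply: normal_pdf_ub; rewrite oner_neq0.
rewrite integral_cst//= lebesgue_measure_itv/= lte_fin.
case: ltP => [_|yx]; first by rewrite -EFinB -EFinM.
by rewrite mule0 lee_fin mulr_ge0 ?normal_peak_ge0 ?subr_ge0.
Qed.

Lemma Phi_lt (x y : R) : x < y -> Phi x < Phi y.
Proof.
move=> xy; rewrite -subr_gt0 -lte_fin Phi_itv ?ltW// /normal_prob.
(* The density is unimodal, so on the interval it is at least the smaller of its endpoint values. *)
pose m := Num.min (normal_pdf 0 1 x) (normal_pdf 0 1 y).
have pdf0 z : 0 < normal_pdf 0 1 z :> R.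
  by rewrite normal_pdfE ?oner_neq0// mulr_gt0 ?expR_gt0// normal_peak_gt0 ?oner_neq0.
have m0 : 0 < m by rewrite lt_min !pdf0.
apply: (@lt_le_trans _ _ (\int[mu]_(z in `]x, y]) m%:E)%E).
  rewrite integral_cst//= lebesgue_measure_itv/= lte_fin xy -EFinB -EFinM lte_fin.
  by rewrite mulr_gt0// subr_gt0.
apply: ge0_le_integral => //.
- by move=> z _; rewrite lee_fin ltW.
- by apply: measurable_funTS; apply/measurable_EFinP; exact: measurable_normal_pdf.
move=> z /=; rewrite in_itv/= => /andP[xz zy]; rewrite lee_fin /m.
rewrite !normal_pdfE ?oner_neq0// /normal_fun !subr0 expr1n.
rewrite ge_min !ler_pM2l ?normal_peak_gt0 ?oner_neq0// !ler_expR.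
have [z0|z0] := leP 0 z; apply/orP; [right|left]; rewrite ler_pM2r ?invr_gt0// lerN2; nra.
Qed.

Lemma Phi_inj : injective (@Phi R).
Proof.
move=> x y xy; have [/Phi_lt|/Phi_lt|//] := ltgtP x y; by rewrite xy ltxx.
Qed.

Lemma probitK : cancel (@Phi R) probit.
Proof.
move=> x; rewrite /probit; case: xgetP => [y _ /Phi_inj//|] /(_ x)/=.
by move=> /(_ erefl).
Qed.

Lemma Phi_continuous : continuous (@Phi R).
Proof.
move=> x; apply/cvgrPdist_lt => e e0.
pose K := normal_peak (1 : R) + 1.
have K0 : 0 < K by rewrite ltr_wpDl ?normal_peak_ge0.
near=> y.
have h : `|x - y| < e / K by near: y; apply: cvgr_dist_lt => //; rewrite divr_gt0.
apply: (@le_lt_trans _ _ (K * `|x - y|)); last by rewrite mulrC -ltr_pdivlMr.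
have [xy|/ltW yx] := leP x y.
  have /andP[h1 h2] := Phi_lipschitz xy.
  rewrite distrC ger0_norm// distrC ger0_norm ?subr_ge0//.
  apply: (le_trans h2); rewrite ler_wpM2r ?subr_ge0// /K; lra.
have /andP[h1 h2] := Phi_lipschitz yx.
rewrite ger0_norm// ger0_norm ?subr_ge0//.
apply: (le_trans h2); rewrite ler_wpM2r ?subr_ge0// /K; lra.
Unshelve. all: by end_near. Qed.

Lemma measurable_Phi : measurable_fun setT (@Phi R).
Proof. apply: continuous_measurable_fun; exact: Phi_continuous. Qed.

Lemma Phi_bounded (x : R) : 0 <= Phi x <= 1.
Proof.
by rewrite -!lee_fin PhiE measure_ge0/= probability_le1.
Qed.

(** An intermediate value argument; it makes the range of [Phi] a measurable set. *)
Lemma range_Phi_interval : is_interval (range (@Phi R)).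
Proof.
move=> _ _ [a _ <-] [b _ <-] q /andP[].
rewrite le_eqVlt => /predU1P[<- _|aq]; first by exists a.
rewrite le_eqVlt => /predU1P[->|qb]; first by exists b.
have ab : a <= b.
  rewrite leNgt; apply/negP => /Phi_lt ba; have := lt_trans aq qb; by rewrite ltNge ltW.
have [||c _ <-] := @IVT R Phi a b q ab; last by exists c.
- by apply: continuous_subspaceT; exact: Phi_continuous.
- by rewrite ge_min le_max (ltW aq) (ltW qb)/= orbT.
Qed.

Lemma measurable_probit : measurable_fun setT (@probit R).
Proof.
have mr : measurable (range (@Phi R)) by apply: is_interval_measurable; exact: range_Phi_interval.
have probit0 p : ~ range (@Phi R) p -> probit p = 0 :> R.
  by move=> np; rewrite /probit; case: xgetP => // x _ /= xp; exfalso; apply: np; exists x.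
apply: (@measurability _ _ _ (measurableTypeR R) setT probit _
  (measurable_realfun.RGenCInfty.measurableE R)).
move=> _ [_ [x ->] <-]; rewrite setTI.
(* Off the range of [Phi] the function [probit] takes the default value 0, which lies in the
   half-line exactly when [x <= 0]. *)
have -> : @probit R @^-1` `[x, +oo[%classic = (range (@Phi R) `&` `[Phi x, +oo[%classic) `|`
    (if x <= 0 then ~` range (@Phi R) else set0).
  apply/seteqP; split => p /=; rewrite !in_itv/= !andbT.
    have [[y _ <-]|np] := pselect (range (@Phi R) p).
      rewrite probitK => xy; left; split; first by exists y.
      by move: xy; rewrite le_eqVlt => /predU1P[->//|/Phi_lt/ltW].
    by rewrite probit0// => ->; right.
  move=> [[[y _ <-]]|].
    rewrite probitK => h; rewrite leNgt; apply/negP => /Phi_lt.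
    by rewrite ltNge h.
  by case: ifPn => // x0 np; rewrite probit0.
apply: measurableU; first by apply: measurableI.
by case: ifPn => // _; exact: measurableC.
Qed.

End standard_cdf.

(** * Almost sure uniqueness of conditional expectations *)

Section conditional_expectation.
Context {R : realType} {d : measure_display} {T : measurableType d}
  (P : probability T R) (Y : T -> R).
Hypothesis mY : measurable_fun setT Y.
Local Notation G := (g_sigma_algebra_preimage Y).

Lemma g_sigma_algebra_preimage_measurable D : G D -> measurable D.
Proof. by move=> [C mC <-]; apply: mY. Qed.

(** The event [q < p] lies in the sub-sigma-algebra, and the positive function [p - q] has integral
    0 over it, so the event is null. *)
Let cond_expectation_le (p q : T -> R) :
  (forall U : set R, measurable U -> G (p @^-1` U)) ->
  (forall U : set R, measurable U -> G (q @^-1` U)) ->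
  P.-integrable setT (EFin \o p) -> P.-integrable setT (EFin \o q) ->
  (forall E, G E -> \int[P]_(w in E) (p w)%:E = \int[P]_(w in E) (q w)%:E)%E ->
  {ae P, forall w, p w <= q w}.
Proof.
move=> Gp Gq ip iq pq.
pose D := [set w | 0 < p w - q w].
have GD : G D.
  have mp : measurable_fun setT (p : g_sigma_algebra_preimageType Y -> R).
    by move=> _ U mU; rewrite setTI; exact: Gp.
  have mq : measurable_fun setT (q : g_sigma_algebra_preimageType Y -> R).
    by move=> _ U mU; rewrite setTI; exact: Gq.
  have mpq : measurable_fun setT (fun w : g_sigma_algebra_preimageType Y => p w - q w).
    exact: measurable_funB.
  have := mpq measurableT _ (measurable_itv `]0%R, +oo[); rewrite setTI.
  rewrite (_ : _ @^-1` _ = D)//.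
  by apply/seteqP; split => w; rewrite /D/= in_itv/= andbT.
have mD := g_sigma_algebra_preimage_measurable GD.
have ipD := integrableS measurableT mD (@subsetT _ _) ip.
have iqD := integrableS measurableT mD (@subsetT _ _) iq.
have ipqD : P.-integrable D (EFin \o (fun w => p w - q w)) by exact: (integrableB mD ipD iqD).
have int0 : (\int[P]_(w in D) `|(EFin \o (fun w => p w - q w)%R) w| = 0)%E.
  transitivity (\int[P]_(w in D) ((p w)%:E - (q w)%:E))%E.
    by apply: eq_integral => w; rewrite inE /D /= => Dw; rewrite ger0_norm// ltW.
  by rewrite integralB_EFin// pq// subee// integrable_fin_num.
have [+ _] := ae_eq_integral_abs P mD (measurable_int P ipqD).
move=> /(_ int0); apply: filterS => w /= h.
rewrite leNgt; apply/negP => qp.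
have Dw : D w by rewrite /D /= subr_gt0.
by have [] := h Dw; move/eqP; rewrite gt_eqF.
Qed.

Lemma cond_expectation_unique (f p q : T -> R) :
  is_cond_expectation P G f p -> is_cond_expectation P G f q ->
  {ae P, forall w, p w = q w}.
Proof.
move=> [Gp ip pf] [Gq iq qf].
have pq := cond_expectation_le Gp Gq ip iq.
have qp := cond_expectation_le Gq Gp iq ip.
have h E : G E -> (\int[P]_(w in E) (p w)%:E = \int[P]_(w in E) (q w)%:E)%E.
  by move=> GE; rewrite pf// qf.
apply: filterS2 (pq h) (qp (fun E GE => esym (h E GE))) => w h1 h2.
by apply/eqP; rewrite eq_le h1 h2.
Qed.

End conditional_expectation.

(** * Forecasts as functions of the observed variable *)

Section forecast.
Context {R : realType} {d : measure_display} {Omega : measurableType d}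
  (P : probability Omega R) (X : set R -> Omega -> R).
Hypothesis hX : gaussian_partial_information P X.
Local Notation gamma := (normal_prob 0 1 : probability (measurableTypeR R) R).
Local Notation mu := (@lebesgue_measure R).
Local Notation kappa := (@kappa R).

(** The scale of X_S - X_B in the normalization of [lincomb_law]: its variance 1 - |B| is divided by
    [kappa]. *)
Definition residual_sd (B : set R) : R := Num.sqrt ((1 - fine (mu B)) / kappa).

Lemma normal_upper_half_line (s a : R) : 0 < s ->
  gamma [set x | 0 < a + s * x] = (Phi (a / s))%:E.
Proof.
move=> s0.
have -> : [set x | 0 < a + s * x] = (fun x => - x) @^-1` `]-oo, a / s[%classic :> set R.
  apply/seteqP; split => x /=; rewrite in_itv/= ltr_pdivlMr//; lra.
rewrite normal_preimageN// PhiE /= /normal_prob.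
rewrite integral_itv_bndo_bndc//; apply: measurable_funTS.
by apply/measurable_EFinP; exact: measurable_normal_pdf.
Qed.

Lemma residual_sd_gt0 B : fine (mu B) < 1 -> 0 < residual_sd B.
Proof. by move=> B1; rewrite sqrtr_gt0 divr_gt0 ?subr_gt0// (kappa_gt0 hX). Qed.

(** X_S is X_B plus the uncorrelated, hence independent, residual X_S - X_B. The probability that a
    constant a plus the residual is positive is [Phi (a / residual_sd B)], and this is integrated
    over the values of X_B in [C]. *)
Lemma forecast_joint (B C : set R) : unit_borel B -> fine (mu B) < 1 -> measurable C ->
  P (X B @^-1` C `&` target_event X) =
  (\int[P]_(w in X B @^-1` C) (Phi (X B w / residual_sd B))%:E)%E.
Proof.
move=> uB B1 mC.
have uS : unit_borel (`[0, 1]%classic : set R) by split; [exact: measurable_itv|].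
pose t (i : 'I_2) : set R := if i == ord0 then B else `[0, 1]%classic.
have ut i : unit_borel (t i) by rewrite /t; case: ifP.
pose u (i : 'I_2) : R := if i == ord0 then 1 else 0.
pose v (i : 'I_2) : R := if i == ord0 then - 1 else 1.
have lu w : lincomb X t u w = X B w.
  by rewrite /lincomb big_ord_recl big_ord1 /u /t /= mul1r mul0r addr0.
have lv w : lincomb X t v w = X `[0, 1]%classic w - X B w.
  by rewrite /lincomb big_ord_recl big_ord1 /v /t /= mul1r mulN1r addrC.
have BS : B `&` `[0, 1] = B by apply/setIidPl; case: uB.
have muS : mu `[0%R, 1%R] = 1%E by rewrite lebesgue_measure_itv/= lte_fin ltr01 oppr0 adde0.
have cuv : lincov t u v = 0.
  by rewrite /lincov !big_ord_recl !big_ord0 /u /v /t /= setIid BS; ring.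
have cvv : lincov t v v = 1 - fine (mu B).
  rewrite /lincov !big_ord_recl !big_ord0 /v /t /= !setIid [_ `&` B]setIC BS muS /=; ring.
pose E : set (measurableTypeR R * measurableTypeR R) := [set z | C z.1 /\ 0 < z.1 + z.2].
have mE : measurable E.
  have -> : E = fst @^-1` C `&` (fun z => z.1 + z.2) @^-1` `]0, +oo[%classic.
    by apply/seteqP; split => z; rewrite /E/= in_itv/= andbT.
  apply: measurableI; rewrite -[X in measurable X]setTI.
    exact: (@measurable_fst _ _ (measurableTypeR R) (measurableTypeR R)).
  have mD : measurable_fun setT (fun z : measurableTypeR R * measurableTypeR R => z.1 + z.2).
    exact: measurable_funD.
  exact: mD.
have s0 := residual_sd_gt0 B1.
have mXC : measurable (X B @^-1` C).
  by rewrite -[X in measurable X]setTI; exact: (measurable_process hX uB).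
transitivity (P ((fun w => (lincomb X t u w, lincomb X t v w)) @^-1` E)).
  congr (P _); apply/seteqP; split => w; rewrite /E/= lu lv /target_event/= addrC subrK//.
rewrite (lincomb_joint_law hX ut cuv mE) cvv -/(residual_sd B) [RHS]integral_mkcond.
apply: eq_integral => w _; rewrite epatch_indic /= indicE lu.
have [wC|wC] := boolP (w \in _).
  rewrite mule1 -normal_upper_half_line//; congr (gamma _).
  apply/seteqP; split => x; rewrite /xsection /= inE /E/=; first by case.
  by move=> ?; split => //; exact: set_mem wC.
rewrite mule0 (_ : _ @^-1` _ = set0) ?measure0//.
apply/seteqP; split => x //; rewrite /xsection /= inE /E/= => -[Cw _].
by move: wC; rewrite mem_set.
Qed.

(** The events of the sub-sigma-algebra are those of the form X_B in C, so [forecast_joint] makes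
    the right-hand side a version of the conditional expectation, and versions agree almost
    surely. *)
Lemma forecast_ae (B : set R) (p : Omega -> R) : unit_borel B -> fine (mu B) < 1 ->
  is_forecast P X B p -> {ae P, forall w, p w = Phi (X B w / residual_sd B)}.
Proof.
move=> uB B1 hp.
have mX := measurable_process hX uB.
have mS : measurable (target_event X).
  have uS : unit_borel (`[0, 1]%classic : set R) by split; [exact: measurable_itv|].
  have -> : target_event X = setT `&` X `[0, 1]%classic @^-1` `]0, +oo[%classic.
    by apply/seteqP; split => w; rewrite /target_event/= in_itv/= andbT; [|case].
  exact: (measurable_process hX uS).
have mq : measurable_fun setT (fun x : R => Phi (x / residual_sd B)).
  by apply: measurableT_comp; [exact: measurable_Phi|exact: measurable_funM].
apply: (cond_expectation_unique mX hp); split.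
- move=> U mU; exists ((fun x : R => Phi (x / residual_sd B)) @^-1` U); last by rewrite setTI.
  by rewrite -[X in measurable X]setTI; exact: mq.
- apply: (@integrable_bounded _ _ _ _ _ 1); first exact: measurableT_comp mq mX.
  by move=> w; have /andP[h0 h1] := Phi_bounded (X B w / residual_sd B); rewrite ger0_norm.
- move=> _ [C mC <-]; rewrite setTI -forecast_joint//.
  rewrite integral_indic//; last by rewrite -[X in measurable X]setTI; exact: mX.
  by rewrite setIC.
Qed.

End forecast.

(** * The law of a ratio *)

Section cauchy.
Context {R : realType}.
Local Notation gamma := (normal_prob 0 1 : probability (measurableTypeR R) R).
Local Notation mu := (@lebesgue_measure R).

Lemma measurable_inv : measurable_fun setT (fun x : R => x^-1).
Proof.
have -> : [set: R] = [set 0] `|` ~` [set 0] by rewrite setUv.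
apply/measurable_funU => //; first exact: measurableC.
split; first exact: measurable_fun_set1.
apply: open_continuous_measurable_fun.
  by apply: closed_openC; exact: closed_eq.
by move=> x; rewrite inE /= => /eqP x0; exact: inv_continuous.
Qed.

(* The joint density, at [(y, z)], of a standard normal [y] and of [x0 + g x / y]. *)
Definition ratio_density (x0 g y z : R) : R :=
  `|y| / (2 * pi * g) * expR (- (y ^+ 2 * ((1 + ((z - x0) / g) ^+ 2) / 2))).

Lemma ratio_density_ge0 (x0 g y z : R) : 0 < g -> 0 <= ratio_density x0 g y z.
Proof.
by move=> g0; rewrite mulr_ge0 ?expR_ge0// divr_ge0// !mulr_ge0 ?pi_ge0// ltW.
Qed.

(** The scale [g / y] may be negative; its absolute value in the normalizing constant produces the
    factor |y|. *)
Lemma ratio_densityE (x0 g y z : R) : 0 < g -> y != 0 ->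
  normal_pdf 0 1 y * normal_pdf x0 (g / y) z = ratio_density x0 g y z.
Proof.
move=> g0 y0; have gn0 : g != 0 by rewrite gt_eqF.
have pin0 : (pi : R) != 0 by rewrite gt_eqF ?pi_gt0.
rewrite !normal_pdfE ?oner_neq0 ?mulf_neq0 ?invr_neq0// /normal_peak /normal_fun.
rewrite mulrACA -invfM -sqrtrM ?mulrn_wge0 ?mulr_ge0 ?sqr_ge0 ?pi_ge0//.
have -> : (1 ^+ 2 * pi *+ 2) * ((g / y) ^+ 2 * pi *+ 2) = (2 * pi * g / y) ^+ 2 by field.
rewrite sqrtr_sqr normrM normfV gtr0_norm ?mulr_gt0 ?pi_gt0// invfM invrK mulrC [_^-1 * _]mulrC.
rewrite /ratio_density mulrC -expRD; congr (_ * expR _).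
by field; rewrite gn0 y0.
Qed.

Lemma measurable_ratio_density (x0 g : R) :
  measurable_fun setT (fun z : measurableTypeR R * measurableTypeR R =>
    ratio_density x0 g z.1 z.2).
Proof.
apply: measurable_funM.
  apply: measurable_funM => //; apply: measurableT_comp => //.
apply: measurableT_comp => //; apply: measurableT_comp => //.
apply: measurable_funM; first exact: measurable_funX.
apply: measurable_funM => //; apply: measurable_funD => //; apply: measurable_funX.
by apply: measurable_funM => //; exact: measurable_funB.
Qed.

(** The integrand is even in [y], and for positive [y] it is a multiple of y exp(-c y^2), which has
    an elementary antiderivative. *)
Lemma integral_ratio_density (x0 g z : R) : 0 < g ->
  (\int[mu]_y (ratio_density x0 g y z)%:E = (cauchy_pdf x0 g z)%:E)%E.
Proof.
move=> g0; have gn0 : g != 0 by rewrite gt_eqF.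
have pin0 : (pi : R) != 0 by rewrite gt_eqF ?pi_gt0.
pose c := (1 + ((z - x0) / g) ^+ 2) / 2.
have c0 : 0 < c by rewrite divr_gt0// ltr_pwDl// sqr_ge0.
pose E : R -> R := expR \o ((- c) *: ((@idfun R : R -> R^o) ^+ 2 : R -> R^o)).
have EE y : E y = expR (- (y ^+ 2 * c)) by rewrite /E !fctE /GRing.scale/=; congr expR; ring.
pose k := (2 * pi * g)^-1.
pose f : R -> R := (k *: (@idfun R : R -> R^o) : R -> R) * E.
have fE y : 0 <= y -> ratio_density x0 g y z = f y.
  by move=> y0; rewrite /f !fctE EE /ratio_density ger0_norm// /GRing.scale/= /k; congr (_ * _); ring.
pose F : R -> R := (- (k / (2 * c))) *: (E : R -> R^o).
have dF (y : R) : is_derive y 1 F (f y).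
  apply: is_derive_eq.
  rewrite /f /E !fctE /GRing.scale/= /k.
  have cn0 : c != 0 by rewrite gt_eqF.
  by move: pin0; move: (pi : R) => q q0; field; rewrite gn0 q0 cn0.
have cf : continuous f by move=> y; apply: is_derive_continuous.
have cE : continuous E by move=> y; apply: is_derive_continuous.
have rE : (fun y => ratio_density x0 g y z) = (fun y => `|y| * k * E y).
  by apply/funext => y; rewrite EE.
have cr : continuous (fun y => ratio_density x0 g y z).
  rewrite rE => y; apply: cvgM; last exact: cE.
  by apply: cvgM; [exact: norm_continuous|exact: cvg_cst].
rewrite (ge0_symfun_integralT _ cr); last 2 first.
- by move=> y; exact: ratio_density_ge0.
- by move=> y; rewrite /ratio_density /= normrN sqrrN.
rewrite -set_itvcy.
have -> : (\int[mu]_(y in `[0%R, +oo[) (ratio_density x0 g y z)%:E =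
    \int[mu]_(y in `[0%R, +oo[) (f y)%:E)%E.
  by apply: eq_integral => y; rewrite inE/= in_itv/= andbT => y0; rewrite fE.
have f0 y : 0 <= y -> 0 <= f y by move=> y0; rewrite -fE// ratio_density_ge0.
have Fl : F y @[y --> +oo] --> 0.
  rewrite -(mulr0 (- (k / (2 * c)))); apply: cvgMr.
  have -> : E = (fun t => expR (- (c * t))) \o (fun y => y ^+ 2).
    by apply/funext => y; rewrite EE /= mulrC.
  by apply: cvg_comp; [exact: cvgr_expr2|exact: cvgr_expRM].
rewrite (@ge0_is_derive_FTC2y _ f F 0 0 f0 dF cf Fl).
rewrite -EFinB -EFinM; congr EFin; rewrite /F fctE EE expr0n mul0r oppr0 expR0.
rewrite /cauchy_pdf /GRing.scale/= /k /c.
have : 1 + ((z - x0) / g) ^+ 2 != 0 by rewrite gt_eqF// ltr_pwDl// sqr_ge0.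
by move: (_ ^+ 2) => w w0; move: pin0; move: (pi : R) => q q0; field; rewrite w0 gn0 q0.
Qed.

(** For fixed nonzero [y] the inner law is normal with mean [x0] and scale [g / y]. Its density
    times that of [y] is [ratio_density], and Tonelli allows [y] to be integrated out first. *)
Theorem normal_ratio_cauchy (x0 g : R) (U : set R) : 0 < g -> measurable U ->
  (\int[gamma]_y gamma ((fun x => (x0 + g / y * x)%R) @^-1` U) = cauchy_law x0 g U)%E.
Proof.
move=> g0 mU; have gn0 : g != 0 by rewrite gt_eqF.
rewrite /cauchy_law (negbTE gn0).
pose E : set (measurableTypeR R * measurableTypeR R) := [set z | U (x0 + g / z.1 * z.2)].
have mE : measurable E.
  have mf : measurable_fun setT
      (fun z : measurableTypeR R * measurableTypeR R => x0 + g / z.1 * z.2).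
    apply: measurable_funD => //; apply: measurable_funM => //; apply: measurable_funM => //.
    by apply: measurableT_comp => //; exact: measurable_inv.
  by have := mf measurableT U mU; rewrite setTI.
have sE y : xsection E y = (fun x => x0 + g / y * x) @^-1` U.
  by apply/seteqP; split => x; rewrite /xsection /= inE.
have mh : measurable_fun setT (fun y : R => gamma ((fun x => x0 + g / y * x) @^-1` U)).
  rewrite (_ : (fun y => _) = (gamma \o xsection E)).
    exact: (@measurable_fun_xsection _ _ _ _ R gamma).
  by apply/funext => y; rewrite /= sE.
pose h (y : R) := fine (gamma ((fun x => x0 + g / y * x) @^-1` U)).
have hE y : (h y)%:E = gamma ((fun x => x0 + g / y * x) @^-1` U).
  by rewrite /h fineK// fin_num_measure// -sE; exact: measurable_xsection.
under eq_integral do rewrite -hE.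
have mh' : measurable_fun setT h by exact: measurableT_comp.
rewrite (@integral_normal_prob _ 0 1 1 h)//; last first.
  move=> y; rewrite ger0_norm ?fine_ge0// -lee_fin hE probability_le1// -sE.
  exact: measurable_xsection.
pose r (z : measurableTypeR R * measurableTypeR R) := (ratio_density x0 g z.1 z.2)%:E.
have mr : measurable_fun setT r by apply/measurable_EFinP; exact: measurable_ratio_density.
have r0 z : (0 <= r z)%E by rewrite lee_fin ratio_density_ge0.
transitivity (\int[mu]_y \int[mu]_(z in U) r (y, z))%E.
  apply: ge0_ae_eq_integral => //.
  - apply: emeasurable_funM; apply/measurable_EFinP => //; exact: measurable_normal_pdf.
  - pose rU (z : measurableTypeR R * measurableTypeR R) := (r z * (\1_U z.2)%:E)%E.
    have mrU : measurable_fun setT rU.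
      apply: emeasurable_funM => //; apply/measurable_EFinP.
      by apply: measurableT_comp => //; exact: measurable_indic.
    have rU0 z : (0 <= rU z)%E by rewrite mule_ge0.
    have := @measurable_fun_fubini_tonelli_F _ _ _ _ R mu rU mrU rU0.
    rewrite /fubini_F (_ : (fun y => _) = (fun y => \int[mu]_(z in U) r (y, z))%E)//.
    apply/funext => y; rewrite [RHS]integral_mkcond; apply: eq_integral => z _.
    by rewrite epatch_indic.
  - by move=> y _; rewrite mule_ge0// lee_fin ?normal_pdf_ge0// fine_ge0.
  - by move=> y _; exact: integral_ge0.
  (* At [y = 0] the quotient [g / y] is 0 by convention and the inner law is a point mass, hence
     this exceptional null set. *)
  - exists [set 0]; split => //; first exact: lebesgue_measure_set1.
    move=> y /=; apply: contra_notP => /eqP y0 _.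
    have -> : (h y)%:E = normal_prob x0 (g / y) U.
      by rewrite hE; apply: normal_prob_affine => //; rewrite mulf_neq0 ?invr_neq0.
    rewrite /normal_prob muleC.
    rewrite -ge0_integralZl_EFin//.
    + by apply: eq_integral => z _; rewrite -EFinM ratio_densityE.
    + by move=> z _; rewrite lee_fin normal_pdf_ge0.
    + by apply: measurable_funTS; apply/measurable_EFinP; exact: measurable_normal_pdf.
    + exact: normal_pdf_ge0.
rewrite (tonelli_on mu mu mU mr r0); apply: eq_integral => z _.
exact: integral_ratio_density.
Qed.

(** For [g > 0] the mass is 1/2 - atan((1 - x0) / g) / pi, with a negative arctangent; for [g = 0]
    the point mass at [x0] lies in the half-line. *)
Lemma cauchy_law_gt1 (x0 g : R) : 1 < x0 -> 0 <= g ->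
  ((2^-1)%:E < cauchy_law x0 g `]1%R, +oo[%classic)%E.
Proof.
move=> x01; rewrite le_eqVlt /cauchy_law => /predU1P[<-|g0].
  rewrite eqxx diracE mem_set/= ?in_itv/= ?andbT// lte_fin invf_lt1// ltr1n//.
have gn0 : g != 0 by rewrite gt_eqF.
have pi0 : 0 < pi :> R := pi_gt0 R.
rewrite (negbTE gn0).
have mf : measurable_fun setT (fun x : R => g^-1 * (1 + (g^-1 * (x - x0)) ^+ 2)^-1).
  apply: measurable_funM => //; apply: measurableT_comp; first exact: measurable_inv.
  by apply: measurable_funD => //; apply: measurable_funX; apply: measurable_funM => //; exact: measurable_funB.
have f0 (x : R) : 0 <= g^-1 * (1 + (g^-1 * (x - x0)) ^+ 2)^-1.
  by rewrite mulr_ge0 ?invr_ge0 ?addr_ge0 ?sqr_ge0// ltW.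
rewrite (_ : integral _ _ _ = (pi^-1)%:E *
    (\int[mu]_(x in `[1%R, +oo[) (g^-1 * (1 + (g^-1 * (x - x0)) ^+ 2)^-1)%:E))%E.
  rewrite cauchy_half_line// -EFinM lte_fin mulrBr.
  have : atan (g^-1 * (1 - x0)) < 0.
    by rewrite -atan0; apply: lt_atan; rewrite pmulr_rlt0 ?invr_gt0// subr_lt0.
  move=> a0; have : pi^-1 * atan (g^-1 * (1 - x0)) < 0 by rewrite pmulr_rlt0 ?invr_gt0.
  have -> : pi^-1 * (pi / 2) = 2^-1 :> R by rewrite mulrA mulVf ?mul1r// gt_eqF.
  lra.
rewrite -integral_itv_obnd_cbnd; last by apply: measurable_funTS; exact/measurable_EFinP.
rewrite -ge0_integralZl_EFin//.
- apply: eq_integral => x _; rewrite -EFinM /cauchy_pdf [(x - x0) / g]mulrC.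
  by rewrite [(pi * g)^-1]invfM -mulrA.
- by move=> x _; rewrite lee_fin.
- by apply: measurable_funTS; exact/measurable_EFinP.
- by rewrite invr_ge0 ltW.
Qed.

End cauchy.

(** * The quotient of two combinations *)

Section ratio_law.
Context {R : realType} {d : measure_display} {Omega : measurableType d}
  (P : probability Omega R) (X : set R -> Omega -> R).
Hypothesis hX : gaussian_partial_information P X.
Local Notation gamma := (normal_prob 0 1 : probability (measurableTypeR R) R).
Local Notation kappa := (@kappa R).

Lemma probability_ae_eq (A B : set Omega) : measurable A -> measurable B ->
  {ae P, forall w, A w <-> B w} -> P A = P B.
Proof.
move=> mA mB AB; rewrite -(setIT A) -(setIT B) -!integral_indic//.
apply: ae_eq_integral => //; [exact/measurable_EFinP/measurable_indic..|].
apply: filterS AB => w AB _; rewrite !indicE; congr (_%:R%:E).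
by apply: congr1; apply/idP/idP; rewrite !inE => /AB.
Qed.

Lemma lincomb_neq0 n (t : 'I_n -> set R) (v : 'I_n -> R) :
  (forall k, unit_borel (t k)) -> 0 < lincov t v v ->
  {ae P, forall w, lincomb X t v w != 0}.
Proof.
move=> ut v0; have mv := measurable_lincomb hX v ut.
have m0 : measurable (lincomb X t v @^-1` [set 0]).
  by rewrite -[X in measurable X]setTI; exact: mv.
exists (lincomb X t v @^-1` [set 0]); split => //; last first.
  by move=> w /= /negP; rewrite negbK => /eqP.
rewrite (lincomb_law hX)//.
have s0 : Num.sqrt (lincov t v v / kappa) != 0.
  by rewrite gt_eqF// sqrtr_gt0 divr_gt0// (kappa_gt0 hX).
have -> : (fun x => Num.sqrt (lincov t v v / kappa) * x) @^-1` [set 0] = [set 0 : R].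
  apply/seteqP; split => x /=; last by move=> ->; rewrite mulr0.
  by move/eqP; rewrite mulf_eq0 (negbTE s0) => /eqP.
by rewrite /= /normal_prob integral_set1.
Qed.

(** Subtracting [x0] times [v] from [u] leaves a residual [r] uncorrelated with [v]. The quotient is
    almost surely [x0] plus a quotient of independent centered normal variables of scales [s] and
    [s'], hence the scale [s / s']. *)
Lemma lincomb_ratio_law n (t : 'I_n -> set R) (u v : 'I_n -> R) :
  (forall k, unit_borel (t k)) -> 0 < lincov t v v ->
  exists2 g, 0 <= g & forall U, measurable U ->
    P ((fun w => lincomb X t u w / lincomb X t v w) @^-1` U) =
    cauchy_law (lincov t u v / lincov t v v) g U.
Proof.
move=> ut v0; set x0 := lincov t u v / lincov t v v.
pose r k := 1 * u k + (- x0) * v k.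
have vr0 : lincov t v r = 0.
  have h (a b : R) : lincov t v (fun k => a * u k + b * v k) = a * lincov t u v + b * lincov t v v.
    rewrite [lincov t u v]lincovC /lincov !mulr_sumr -!big_split/=; apply: eq_bigr => i _.
    rewrite !mulr_sumr -!big_split/=; apply: eq_bigr => j _; ring.
  by rewrite h mul1r mulNr /x0 divfK ?subrr// gt_eqF.
have k0 := kappa_gt0 hX.
pose s := Num.sqrt (lincov t r r / kappa).
pose s' := Num.sqrt (lincov t v v / kappa).
have s'0 : 0 < s' by rewrite sqrtr_gt0 divr_gt0.
have s0 : 0 <= s by exact: sqrtr_ge0.
exists (s / s'); first by rewrite divr_ge0// ltW.
move=> U mU.
pose E : set (measurableTypeR R * measurableTypeR R) := [set z | U (x0 + z.2 / z.1)].
have mE : measurable E.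
  have mf : measurable_fun setT
      (fun z : measurableTypeR R * measurableTypeR R => x0 + z.2 / z.1).
    apply: measurable_funD => //; apply: measurable_funM => //.
    by apply: measurableT_comp => //; exact: measurable_inv.
  by have := mf measurableT U mU; rewrite setTI.
have mv := measurable_lincomb hX v ut.
have mu' := measurable_lincomb hX u ut.
have mr := measurable_lincomb hX r ut.
have muv : measurable_fun setT (fun w => lincomb X t u w / lincomb X t v w).
  by apply: measurable_funM => //; apply: measurableT_comp => //; exact: measurable_inv.
have mvr : measurable_fun setT (fun w => (lincomb X t v w, lincomb X t r w)).
  exact/measurable_fun_pairP.
have -> : P ((fun w => lincomb X t u w / lincomb X t v w) @^-1` U) =
    P ((fun w => (lincomb X t v w, lincomb X t r w)) @^-1` E).
  apply: probability_ae_eq.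
  - by rewrite -[X in measurable X]setTI; exact: muv.
  - by rewrite -[X in measurable X]setTI; exact: mvr.
  - apply: filterS (lincomb_neq0 ut v0) => w v0w /=; rewrite /E/=.
    have -> : lincomb X t r w = lincomb X t u w - x0 * lincomb X t v w.
      by rewrite /r -lincombD mul1r mulNr.
    have -> : x0 + (lincomb X t u w - x0 * lincomb X t v w) / lincomb X t v w =
      lincomb X t u w / lincomb X t v w by field.
    by [].
rewrite (lincomb_joint_law hX ut vr0 mE) -/s.
pose h (y : R) := fine (gamma ((fun x => s * x)%R @^-1` xsection E y)).
have mxE y : measurable ((fun x => s * x) @^-1` xsection E y).
  rewrite -[X in measurable X]setTI.
  have ms : measurable_fun setT (fun x : R => s * x) by exact: measurable_funM.
  by apply: ms => //; exact: measurable_xsection.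
have hE y : (h y)%:E = gamma ((fun x => s * x)%R @^-1` xsection E y).
  by rewrite /h fineK// fin_num_measure//; exact: mxE.
(* Moving the scaling by [s] into the set makes the measurability of section measures applicable. *)
pose E' : set (measurableTypeR R * measurableTypeR R) := [set z | E (z.1, s * z.2)].
have mE' : measurable E'.
  have mf : measurable_fun setT
      (fun z : measurableTypeR R * measurableTypeR R => (z.1, s * z.2)).
    apply/measurable_fun_pairP; split; first exact: measurable_fst.
    by apply: measurable_funM => //; exact: measurable_snd.
  by have := mf measurableT E mE; rewrite setTI.
have sE' y : xsection E' y = (fun x => s * x) @^-1` xsection E y.
  by apply/seteqP; split => x; rewrite /xsection /E' /= !inE.
have mh : measurable_fun setT h.
  rewrite (_ : h = fine \o (gamma \o xsection E')).
    by apply: measurableT_comp => //; exact: (@measurable_fun_xsection _ _ _ _ R gamma).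
  by apply/funext => y; rewrite /h /= sE'.
have hC y : `|h y| <= 1.
  by rewrite ger0_norm ?fine_ge0// -lee_fin hE probability_le1//; exact: mxE.
under eq_integral do rewrite -hE.
have ms' : measurable_fun setT (fun x : R => s' * x) by exact: measurable_funM.
rewrite (@eq_law_integral _ _ _ _ _ P gamma (lincomb X t v) (fun x => s' * x) h 1 mv ms' _ mh hC); last first.
  by move=> A mA; rewrite (lincomb_law hX).
(* A residual of variance 0 makes the quotient almost surely constant, which is the degenerate case
   of [cauchy_law]. *)
move: s0; rewrite le_eqVlt => /predU1P[s0|s0].
  rewrite /cauchy_law -s0 mul0r eqxx diracE.
  have hx y : h y = (x0 \in U)%:R.
    rewrite /h (_ : _ @^-1` _ = if x0 \in U then setT else set0); last first.
      apply/seteqP; split => x; rewrite /= -s0 mul0r /xsection /= inE /E/= mul0r addr0.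
        by move=> /mem_set ->.
      by case: ifPn => // /set_mem.
    by case: ifPn => _; rewrite ?probability_setT ?measure0.
  under eq_integral do rewrite hx.
  by rewrite integral_cst//= probability_setT mule1.
rewrite -normal_ratio_cauchy ?divr_gt0//.
apply: eq_integral => y _; rewrite hE; congr (gamma _).
have fE x : x0 + s * x / (s' * y) = x0 + s / s' / y * x by rewrite invfM; ring.
by apply/seteqP; split => x; rewrite /xsection /= inE /E/= fE.
Qed.

End ratio_law.

(** * The location parameter *)

Section extremization_center.
Context {R : realType} (N : nat) (s : 'I_N -> R) (s' : R) (m : 'I_N -> 'I_N -> R).
Hypotheses (N0 : (0 < N)%N) (s'0 : 0 < s') (s's : forall i, s' <= s i)
  (m0 : forall i j, 0 <= m i j) (mle : forall i j, m i j <= m i i).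

(** In the application [m i j] is the measure of the intersection of B_i and B_j, [a] lists the
    coefficients of V, [num] is Cov(U, V) and [den] is Var(V). *)
Let a (i : 'I_N) : R := N%:R^-1 / s i.
Let num := \sum_(i < N) s'^-1 * a i * m i i.
Let den := \sum_(i < N) \sum_(j < N) a i * a j * m i j.

Let s0 i : 0 < s i. Proof. exact: lt_le_trans s'0 (s's i). Qed.

Let Nr0 : 0 < N%:R :> R. Proof. by rewrite ltr0n. Qed.

Let a0 i : 0 < a i. Proof. by rewrite divr_gt0 ?invr_gt0. Qed.

(** The term of index [i] in [num] is spread evenly over the [N] indices [j]; [gap i j] is the
    excess of one share over the corresponding term of [den]. *)
Let gap i j := a i * N%:R^-1 * (s'^-1 * m i i - (s j)^-1 * m i j).

Let gap_ge0 i j : 0 <= gap i j.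
Proof.
apply: mulr_ge0; first by rewrite mulr_ge0 ?invr_ge0 ?(ltW (a0 i)) ?(ltW Nr0).
have sj : 0 <= (s j)^-1 by rewrite invr_ge0 ltW.
by rewrite subr_ge0; apply: ler_pM => //; rewrite lef_pV2 ?posrE.
Qed.

Let row_gap_ge0 i : 0 <= \sum_(j < N) gap i j.
Proof. by apply: sumr_ge0 => j _; exact: gap_ge0. Qed.

Let numE : num - den = \sum_(i < N) \sum_(j < N) gap i j.
Proof.
rewrite -sumrB; apply: eq_bigr => i _.
have -> : s'^-1 * a i * m i i = \sum_(j < N) a i * N%:R^-1 * (s'^-1 * m i i).
  rewrite sumr_const card_ord -mulr_natr.
  by field; rewrite ?[X in _ && X]gt_eqF ?gt_eqF.
by rewrite -sumrB; apply: eq_bigr => j _; rewrite /gap /a; ring.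
Qed.

Lemma extremization_den_le : den <= num.
Proof.
by rewrite -subr_ge0 numE; apply: sumr_ge0 => i _; exact: row_gap_ge0.
Qed.

(** Nonnegative gaps with sum 0 all vanish. Where [m i i != 0] this gives m_ii / s' = m_ij / s_j <=
    m_ii / s_j, whence s_j <= s'. *)
Lemma extremization_den_eq : den = num -> forall i j, m i i != 0 -> s j = s'.
Proof.
move=> dn i j mi.
have row0 : \sum_(j < N) gap i j = 0.
  have S0 : \sum_(i < N) \sum_(j < N) gap i j = 0 by rewrite -numE dn subrr.
  exact: (psumr_eq0P (fun k _ => row_gap_ge0 k) S0).
have gap0 : gap i j = 0 by exact: (psumr_eq0P (fun k _ => gap_ge0 i k) row0).
have eqm : s'^-1 * m i i = (s j)^-1 * m i j.
  apply/eqP; rewrite -subr_eq0; have /eqP := gap0.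
  by rewrite /gap mulf_eq0 gt_eqF//= mulr_gt0 ?invr_gt0.
have mi0 : 0 < m i i by rewrite lt_neqAle eq_sym mi m0.
apply/eqP; rewrite eq_le s's andbT -lef_pV2 ?posrE//.
by rewrite -(ler_pM2r mi0) eqm ler_pM2l ?invr_gt0.
Qed.

Lemma extremization_den_gt0 i : m i i != 0 -> 0 < den.
Proof.
move=> mi.
have mi0 : 0 < m i i by rewrite lt_neqAle eq_sym mi m0.
have t0 k l : 0 <= a k * a l * m k l.
  by apply: mulr_ge0 => //; rewrite mulr_ge0// ltW.
rewrite /den (bigD1 i)//= ltr_pwDl//; last first.
  by apply: sumr_ge0 => k _; apply: sumr_ge0.
rewrite (bigD1 i)//= ltr_pwDl//; last by apply: sumr_ge0.
exact: mulr_gt0 (mulr_gt0 (a0 i) (a0 i)) mi0.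
Qed.

End extremization_center.

(** * The Cauchy law of the extremization ratio and the bound on its location *)

Theorem proposition4p2 (R : realType) (d : measure_display)
    (Omega : measurableType d) (P : probability Omega R)
    (X : set R -> Omega -> R) (hX : gaussian_partial_information P X)
    (N : nat) (hN : (1 <= N)%N)
    (B : 'I_N -> set R) (hB : forall i, unit_borel (B i))
    (delta : 'I_N -> R) (hdelta : forall i, delta i = fine (lebesgue_measure (B i)))
    (B' : set R) (hB' : B' = \bigcup_i B i)
    (delta' : R) (hdelta' : delta' = fine (lebesgue_measure B'))
    (hdelta'0 : 0 < delta') (hdelta'1 : delta' < 1)
    (p : 'I_N -> Omega -> R) (hp : forall i, is_forecast P X (B i) (p i))
    (p' : Omega -> R) (hp' : is_forecast P X B' p')
    (alpha : Omega -> R)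
    (halpha : alpha = extremization_ratio p' (average_probit p)) :
  (exists x0 gamma : R,
     [/\ 0 <= gamma,
         has_law P alpha (cauchy_law x0 gamma),
         1 <= x0 &
         x0 = 1 -> forall i j : 'I_N, i != j -> delta i = delta j]) /\
  ((exists i j : 'I_N, i != j /\ delta i <> delta j) ->
     ((2^-1)%:E < P [set w | (1 < alpha w)%R])%E).
Proof.
have k0 := kappa_gt0 hX.
have uB' : unit_borel B'.
  rewrite hB'; split; last by move=> x [i _ /(hB i).2].
  by apply: fin_bigcup_measurable => // i _; case: (hB i).
have BB' i : B i `<=` B' by rewrite hB' => x Bx; exists i.
have BIB' i : B' `&` B i = B i by apply/setIidPr.
have fm C D : unit_borel C -> unit_borel D -> C `<=` D ->
    fine (lebesgue_measure C) <= fine (lebesgue_measure D).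
  move=> uC uD CD; rewrite fine_le ?unit_borel_fin_num//.
  by apply: le_measure => //; rewrite inE; [case: uC|case: uD].
have dle i : delta i <= delta' by rewrite hdelta hdelta'; exact: fm.
have d1 i : fine (lebesgue_measure (B i)) < 1.
  by rewrite -hdelta; exact: le_lt_trans (dle i) hdelta'1.
have d'1 : fine (lebesgue_measure B') < 1 by rewrite -hdelta'.
(* Otherwise subadditivity would give the union measure 0. The set found here makes Var(V)
   positive. *)
have [i0 di0] : exists i, delta i != 0.
  apply: contrapT => /forallNP h.
  have d0 i : lebesgue_measure (B i) = 0%E.
    have /negP := h i; rewrite negbK hdelta => /eqP d0.
    by rewrite -[LHS]fineK ?unit_borel_fin_num// d0.
  have : (lebesgue_measure B' <= 0)%E.
    apply: (@le_trans _ _ (\sum_(i \in [set: 'I_N]) lebesgue_measure (B i))%E).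
      apply: content_sub_fsum; rewrite -?hB'//.
      - exact: finite_finset.
      - by move=> i _; case: (hB i).
      - by case: uB'.
    by rewrite fsbig1.
  move=> l0; move: hdelta'0; rewrite hdelta' ltNge => /negP; apply.
  have -> : lebesgue_measure B' = 0%E by apply/eqP; rewrite eq_le l0 measure_ge0.
  by [].
pose s i := residual_sd (B i); pose s' := residual_sd B'.
have s'0 : 0 < s' by exact: residual_sd_gt0 hX _ d'1.
have s's i : s' <= s i.
  by rewrite ler_wsqrtr// ler_pM2r ?invr_gt0// lerD2l lerN2 -hdelta -hdelta'.
pose m i j := fine (lebesgue_measure (B i `&` B j)).
have m0 i j : 0 <= m i j by rewrite fine_ge0.
have mii i : m i i = delta i by rewrite /m setIid hdelta.
have mle i j : m i j <= m i i.
  by apply: fm; [exact: unit_borelI|exact: unit_borelI|rewrite setIid; exact: subIsetl].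
(* Index 0 carries B' and index [lift ord0 i] carries B_i, so that U and V are combinations of a
   single family. *)
pose t (k : 'I_N.+1) : set R := oapp B B' (unlift ord0 k).
have ut k : unit_borel (t k) by rewrite /t; case: (unlift ord0 k).
have t0 : t ord0 = B' by rewrite /t unlift_none.
have tl i : t (lift ord0 i) = B i by rewrite /t liftK.
pose u (k : 'I_N.+1) : R := oapp (fun=> 0) s'^-1 (unlift ord0 k).
pose v (k : 'I_N.+1) : R := oapp (fun i => N%:R^-1 / s i) 0 (unlift ord0 k).
have u0 : u ord0 = s'^-1 by rewrite /u unlift_none.
have ul i : u (lift ord0 i) = 0 by rewrite /u liftK.
have v0 : v ord0 = 0 by rewrite /v unlift_none.
have vl i : v (lift ord0 i) = N%:R^-1 / s i by rewrite /v liftK.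
have lu w : lincomb X t u w = X B' w / s'.
  rewrite /lincomb big_ord_recl u0 t0 big1 ?addr0 1?mulrC// => i _.
  by rewrite ul mul0r.
have lv w : lincomb X t v w = N%:R^-1 * \sum_(i < N) X (B i) w / s i.
  rewrite /lincomb big_ord_recl v0 mul0r add0r mulr_sumr; apply: eq_bigr => i _.
  by rewrite vl tl; ring.
(* Each B_i lies in B', so the covariance of X_B' and X_{B_i} is the measure of B_i. *)
have cuv : lincov t u v = \sum_(i < N) s'^-1 * (N%:R^-1 / s i) * m i i.
  rewrite /lincov big_ord_recl [X in _ + X]big1 ?addr0; last first.
    by move=> i _; rewrite big1// => j _; rewrite ul !mul0r.
  rewrite big_ord_recl v0 mulr0 mul0r add0r; apply: eq_bigr => i _.
  by rewrite u0 vl t0 tl BIB' /m setIid.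
have cvv : lincov t v v = \sum_(i < N) \sum_(j < N) (N%:R^-1 / s i) * (N%:R^-1 / s j) * m i j.
  rewrite /lincov big_ord_recl big1 ?add0r; last by move=> j _; rewrite v0 !mul0r.
  apply: eq_bigr => i _; rewrite big_ord_recl v0 mulr0 mul0r add0r.
  by apply: eq_bigr => j _; rewrite !vl !tl.
have cvv0 : 0 < lincov t v v.
  by rewrite cvv; apply: (@extremization_den_gt0 _ _ _ _ _ hN s'0 s's m0 i0); rewrite mii.
have [g g0 ratioE] := lincomb_ratio_law hX u ut cvv0.
have malpha : measurable_fun setT alpha.
  have mpr i : measurable_fun setT (p i).
    move=> _ U mU; rewrite setTI; case: (hp i) => [/(_ U mU) h _ _].
    exact: (g_sigma_algebra_preimage_measurable (measurable_process hX (hB i)) h).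
  have mpr' : measurable_fun setT p'.
    move=> _ U mU; rewrite setTI; case: hp' => [/(_ U mU) h _ _].
    exact: (g_sigma_algebra_preimage_measurable (measurable_process hX uB') h).
  rewrite halpha /extremization_ratio; apply: measurable_funM.
    exact: measurableT_comp measurable_probit mpr'.
  apply: measurableT_comp; first exact: measurable_inv.
  apply: measurableT_comp; first exact: measurable_probit.
  apply: measurableT_comp; first exact: measurable_Phi.
  apply: measurable_funM => //; apply: measurable_sum => i.
  exact: measurableT_comp measurable_probit (mpr i).
(* The finitely many forecasts equal their formulas simultaneously almost surely, and [probit]
   undoes [Phi]. *)
have alphaE : {ae P, forall w, alpha w = lincomb X t u w / lincomb X t v w}.
  have aep : {ae P, forall w, forall i, p i w = Phi (X (B i) w / s i)}.
    by apply: filter_forall => i; exact: (forecast_ae hX (hB i) (d1 i) (hp i)).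
  have aep' := forecast_ae hX uB' d'1 hp'.
  apply: filterS2 aep aep' => w pw p'w.
  rewrite halpha /extremization_ratio /average_probit p'w !probitK lu lv.
  by congr (_ / (_ * _)); apply: eq_bigr => i _; rewrite pw probitK.
have lawE : has_law P alpha (cauchy_law (lincov t u v / lincov t v v) g).
  split => // U mU; rewrite -ratioE//; apply: probability_ae_eq.
  - by rewrite -[X in measurable X]setTI; exact: malpha.
  - have mr : measurable_fun setT (fun w => lincomb X t u w / lincomb X t v w).
      apply: measurable_funM; first exact: (measurable_lincomb hX _ ut).
      by apply: measurableT_comp; [exact: measurable_inv|exact: (measurable_lincomb hX _ ut)].
    by rewrite -[X in measurable X]setTI; exact: mr.
  - by apply: filterS alphaE => w /= ->.
have x0_ge1 : 1 <= lincov t u v / lincov t v v.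
  by rewrite ler_pdivlMr// mul1r cuv cvv; exact: extremization_den_le.
(* One row of positive measure, that of [i0], forces every scale to be that of B'; squaring the
   scales then makes every [delta i] equal to [delta']. *)
have x0_eq1 : lincov t u v / lincov t v v = 1 -> forall i j : 'I_N, i != j -> delta i = delta j.
  move=> x01; have dn : lincov t v v = lincov t u v.
    by rewrite -[RHS](divfK (lt0r_neq0 cvv0)) x01 mul1r.
  suff dE i : delta i = delta' by move=> i j _; rewrite !dE.
  have sE : s i = s'.
    move: dn; rewrite cuv cvv => /(extremization_den_eq hN s'0 s's m0 mle) h.
    by apply: (h i0); rewrite mii.
  have /(congr1 (fun x => x ^+ 2)) := sE.
  rewrite !sqr_sqrtr ?divr_ge0 ?subr_ge0 1?ltW// => /(mulIf (_ : (@kappa R)^-1 != 0)).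
  by rewrite invr_eq0 gt_eqF// => /(_ isT) /addrI /oppr_inj; rewrite hdelta hdelta'.
split; first by exists (lincov t u v / lincov t v v), g.
move=> [i [j [ij dij]]].
have x0_gt1 : 1 < lincov t u v / lincov t v v.
  rewrite lt_neqAle x0_ge1 andbT eq_sym; apply/negP => /eqP /x0_eq1 h.
  by apply: dij; exact: h.
have -> : [set w | 1 < alpha w] = alpha @^-1` `]1, +oo[%classic.
  by apply/seteqP; split => w /=; rewrite in_itv/= andbT.
by rewrite lawE.2//; exact: cauchy_law_gt1.
Qed.
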